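(* For any $\beta>0$ and any positive $r_A,r_B,r_C$ with $r_A+r_B+r_C=1$ which are not all equal to $1/3$, there exists at most one type-1 ELE solution with mean densities $r_A,r_B,r_C$.
   Context: An ELE solution with mean densities $r_A,r_B,r_C$ (at inverse temperature $\beta$) is a triple $\rho=(\rho_A,\rho_B,\rho_C)$ of differentiable functions on $[0,1]$ with $0<\rho_\alpha(x)<1$, $\rho_A+\rho_B+\rho_C\equiv1$, satisfying $$\rho_A'=\beta\rho_A(\rho_C-\rho_B),\quad \rho_B'=\beta\rho_B(\rho_A-\rho_C),\quad \rho_C'=\beta\rho_C(\rho_B-\rho_A),$$ and $\int_0^1\rho_\alpha(x)\,dx=r_\alpha$. For such a solution the product $\rho_A\rho_B\rho_C$ is a constant $K\in(0,1/27]$. For $0<K<1/27$ the polynomial $U_K(y)=\tfrac12Ky-\tfrac18y^2(1-y)^2$ has zeros $0<a(K)<b(K)<1<c(K)$ with $U_K<0$ on $(a,b)$; set $\tau_K=2\int_{a(K)}^{b(K)}dy/\sqrt{-2U_K(y)}$. A solution with $K<1/27$ is of type 1 if $2\beta\le\tau_K$. *)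

(* Defs.v *)
From Stdlib Require Import Reals Lra.
From Coquelicot Require Import Coquelicot.
Open Scope R_scope.

Definition is_derive_01 (f : R -> R) (x d : R) : Prop :=
  filterlim (fun h => (f (x + h) - f x) / h)
    (within (fun h => h <> 0 /\ 0 <= x + h <= 1) (locally 0))
    (locally d).

Definition ELE_solution (beta rA rB rC : R) (pA pB pC : R -> R) : Prop :=
  (forall x, 0 <= x <= 1 ->
     0 < pA x < 1 /\ 0 < pB x < 1 /\ 0 < pC x < 1 /\
     pA x + pB x + pC x = 1 /\
     is_derive_01 pA x (beta * pA x * (pC x - pB x)) /\
     is_derive_01 pB x (beta * pB x * (pA x - pC x)) /\
     is_derive_01 pC x (beta * pC x * (pB x - pA x))) /\
  is_RInt pA 0 1 rA /\ is_RInt pB 0 1 rB /\ is_RInt pC 0 1 rC.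

(* The constant K = rhoA * rhoB * rhoC of a solution (evaluated at 0). *)
Definition ELE_K (pA pB pC : R -> R) : R := pA 0 * pB 0 * pC 0.

Definition U_K (K y : R) : R := / 2 * K * y - / 8 * y ^ 2 * (1 - y) ^ 2.

Definition is_tau (K t : R) : Prop :=
  exists a b c : R,
    0 < a /\ a < b /\ b < 1 /\ 1 < c /\
    U_K K a = 0 /\ U_K K b = 0 /\ U_K K c = 0 /\
    (forall y, a < y < b -> U_K K y < 0) /\
    is_RInt_gen (fun y => / sqrt (- 2 * U_K K y)) (at_right a) (at_left b) (t / 2).

Definition ELE_type1 (beta : R) (pA pB pC : R -> R) : Prop :=
  ELE_K pA pB pC < / 27 /\
  exists t, is_tau (ELE_K pA pB pC) t /\ 2 * beta <= t.

(* Main.v *)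
Require Import Defs.
From Stdlib Require Import Reals Lra Psatz Classical.
From Coquelicot Require Import Coquelicot.
Open Scope R_scope.

(** Integrating the logarithmic derivatives, the mean densities determine the ratios
    [rho_i(1) / rho_i(0)].  So two solutions [p], [q] with the same means have
    [u = ln p - ln q] equal at times [0] and [1].  The flow is Hamiltonian for a convex
    function of [ln rho], so [u] turns strictly monotonically and must make a full turn in
    [[0, 1]] unless it vanishes.  Let [p] be on the outer orbit ([K_p <= K_q]).  Its period
    is at least that of [q], so when [q] has completed its period [p] has not
    overtaken its starting point; seen from the inner orbit the chord from [q] to [p] has
    then not made a full turn, a contradiction.

    The period decreases with [K]: a Moebius change of variable turns the elliptic integral
    into [int dth / sqrt (m^2 sin^2 th + g^2 cos^2 th)], where [m] and [g] are the result of
    one step of the arithmetic-geometric mean, and both increase with [K]. *)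

(** * Real functions *)

(** The monotone turning comes from one positivity: [u' = beta * J (p - q)], where [J] is a multiple
    of a quarter turn on the plane of vectors of sum zero, and the inner product of [u] with [p - q]
    is the sum of the two relative entropies of [p] and [q]. No angle is ever defined. With
    [v = u 0], the determinant of [v], [u] and [(1, 1, 1)] vanishes exactly when [u] is a multiple
    of [v] modulo constants, and the sign of its derivative there tells the two directions apart.
    The inequality [K_p <= K_q] then places [p], seen from the centre of the simplex, on the side to
    which [u] points. Turns of [p] are counted by the fact that a line through the centre meets an
    orbit only twice. The given solutions live on [[0, 1]], whereas the comparison follows both
    orbits for a period. Each is therefore replaced by a global solution, built explicitly so that
    its period and its injectivity come with the construction. *)

Lemma derive_zero_const (f : R -> R) (x y : R) :
  (forall t, is_derive f t 0) -> f x = f y.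
Proof.
intros H.
destruct (MVT_gen f x y (fun _ => 0)) as [c [_ Hc]].
- intros; apply H.
- intros t _; apply continuity_pt_filterlim.
  apply (ex_derive_continuous f); exists 0; apply H.
- lra.
Qed.

Lemma derive_pos_incr (f f' : R -> R) (a b : R) :
  a < b -> (forall t, is_derive f t (f' t)) ->
  (forall t, a <= t <= b -> 0 < f' t) -> f a < f b.
Proof.
intros ab H Hp.
destruct (MVT_gen f a b f') as [c [Hc E]].
- intros; apply H.
- intros t _; apply continuity_pt_filterlim.
  apply (ex_derive_continuous f); eexists; apply H.
- rewrite Rmin_left, Rmax_right in Hc by lra.
  specialize (Hp c Hc); nra.
Qed.

Lemma derive_pos_right (g : R -> R) (x l y : R) :
  is_derive g x l -> 0 < l -> x < y ->
  exists t, x < t < y /\ g x < g t.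
Proof.
intros H Hl xy.
apply is_derive_Reals in H.
destruct (H (l / 2) ltac:(lra)) as [d Hd].
set (k := Rmin (d / 2) ((y - x) / 2)).
assert (k0 : 0 < k) by (apply Rmin_pos; [destruct d; simpl; lra | lra]).
assert (k1 : k <= d / 2) by apply Rmin_l.
assert (k2 : k <= (y - x) / 2) by apply Rmin_r.
exists (x + k); split; [lra|].
specialize (Hd k ltac:(lra)).
rewrite Rabs_pos_eq in Hd by lra.
specialize (Hd ltac:(destruct d; simpl in *; lra)).
apply Rabs_def2 in Hd as [_ Hd].
assert (0 < (g (x + k) - g x) / k) by lra.
assert (0 < (g (x + k) - g x) / k * k) by (apply Rmult_lt_0_compat; lra).
replace ((g (x + k) - g x) / k * k) with (g (x + k) - g x) in H1 by (field; lra).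
lra.
Qed.

Lemma derive_pos_left (g : R -> R) (x l y : R) :
  is_derive g x l -> 0 < l -> y < x ->
  exists t, y < t < x /\ g t < g x.
Proof.
intros H Hl yx.
assert (H' : is_derive (fun t => - g (- t)) (- x) l).
{ replace l with (- (-1 * l)) by ring.
  apply (is_derive_opp (fun t => g (- t))).
  apply (is_derive_comp g Ropp).
  - now rewrite Ropp_involutive.
  - auto_derive; [exact I | ring]. }
destruct (derive_pos_right _ _ _ (- y) H' Hl ltac:(lra)) as [t [Ht E]].
exists (- t); rewrite Ropp_involutive in E; split; lra.
Qed.

(** The supremum of the initial interval of positivity is a zero, and a positive derivative there
    would make [g] negative just before it. *)
Lemma first_zero (g g' : R -> R) (x0 x1 : R) :
  (forall t, is_derive g t (g' t)) -> x0 < x1 -> 0 < g x0 -> g x1 <= 0 ->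
  exists t, x0 < t <= x1 /\ g t = 0 /\ g' t <= 0.
Proof.
intros H x01 G0 G1.
assert (gc : forall t, continuity_pt g t).
{ intros t; apply continuity_pt_filterlim, (ex_derive_continuous g).
  eexists; apply H. }
set (P := fun x => x0 <= x <= x1 /\ forall y, x0 <= y <= x -> 0 < g y).
destruct (completeness P) as [t [tu tl]].
{ exists x1; intros x [? _]; lra. }
{ exists x0; split; [lra|]; intros y ?; now replace y with x0 by lra. }
assert (t0 : x0 <= t).
{ apply tu; split; [lra|]; intros y ?; now replace y with x0 by lra. }
assert (t1 : t <= x1) by (apply tl; intros x [? _]; lra).
assert (below : forall y, x0 <= y < t -> 0 < g y).
{ intros y Hy; destruct (Rlt_le_dec 0 (g y)) as [|N]; [assumption|].
  exfalso; cut (t <= y); [lra|].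
  apply tl; intros x [Hx Px].
  destruct (Rle_lt_dec x y) as [|yx]; [assumption|].
  specialize (Px y ltac:(lra)); lra. }
assert (gt : g t = 0).
{ destruct (Rtotal_order (g t) 0) as [N|[E|N]]; [|exact E|]; exfalso.
  - destruct (gc t (- g t) ltac:(lra)) as [d [d0 Hd]].
    assert (x0 < t).
    { destruct (Req_dec x0 t) as [<-|]; lra. }
    set (y := Rmax x0 (t - d / 2)).
    assert (x0 <= y) by apply Rmax_l.
    assert (t - d / 2 <= y) by apply Rmax_r.
    assert (y < t) by (unfold y; apply Rmax_lub_lt; lra).
    specialize (below y ltac:(lra)).
    specialize (Hd y).
    assert (Hy : D_x no_cond t y /\ dist R_met y t < d).
    { split; [split; [exact I | lra]|].
      simpl; unfold R_dist; rewrite Rabs_left by lra; lra. }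
    specialize (Hd Hy); simpl in Hd; unfold R_dist in Hd.
    apply Rabs_def2 in Hd; lra.
  - destruct (gc t (g t) ltac:(lra)) as [d [d0 Hd]].
    assert (t < x1).
    { destruct (Req_dec t x1) as [E|]; [rewrite E in N|]; lra. }
    set (y := Rmin x1 (t + d / 2)).
    assert (y <= x1) by apply Rmin_l.
    assert (y <= t + d / 2) by apply Rmin_r.
    assert (t < y) by (unfold y; apply Rmin_glb_lt; lra).
    cut (y <= t); [lra|].
    apply tu; split; [lra|].
    intros w Hw.
    destruct (Rlt_le_dec w t) as [|tw]; [apply below; lra|].
    destruct (Req_dec w t) as [->|]; [exact N|].
    specialize (Hd w).
    assert (Hy : D_x no_cond t w /\ dist R_met w t < d).
    { split; [split; [exact I | lra]|].
      simpl; unfold R_dist; rewrite Rabs_pos_eq; lra. }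
    specialize (Hd Hy); simpl in Hd; unfold R_dist in Hd.
    apply Rabs_def2 in Hd; lra. }
exists t.
assert (x0 < t) by (destruct (Req_dec x0 t) as [E|]; [rewrite E in G0|]; lra).
split; [lra|]; split; [exact gt|].
destruct (Rle_lt_dec (g' t) 0) as [|N]; [assumption|exfalso].
destruct (derive_pos_left g t (g' t) x0 (H t) N ltac:(lra)) as [y [Hy E]].
specialize (below y ltac:(lra)); lra.
Qed.

(** Solution of [g' = 1 / f g] by quadrature. The lower bound [c] makes the integral onto the whole
    line and its inverse Lipschitz, so the solution is global. *)
Lemma inverse_of_integral (f : R -> R) (c : R) :
  0 < c -> (forall x, continuous f x) -> (forall x, c <= f x) ->
  exists g : R -> R,
    (forall t, RInt f 0 (g t) = t) /\ (forall x, g (RInt f 0 x) = x) /\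
    (forall t, is_derive g t (/ f (g t))).
Proof.
intros c0 fc fl.
set (P := fun x => RInt f 0 x).
assert (dP : forall x, is_derive P x (f x)).
{ intros x; apply (is_derive_RInt f P 0 x); [|apply fc].
  exists (mkposreal 1 Rlt_0_1); intros y _.
  apply (@RInt_correct R_CompleteNormedModule), ex_RInt_continuous.
  intros; apply fc. }
assert (Pc : forall x, continuity_pt P x).
{ intros x; apply continuity_pt_filterlim, (ex_derive_continuous P).
  eexists; apply dP. }
assert (P0 : P 0 = 0) by apply (@RInt_point R_CompleteNormedModule).
assert (grow : forall x y, x <= y -> c * (y - x) <= P y - P x).
{ intros x y xy.
  destruct (MVT_gen P x y f) as [w [_ E]]; [intros; apply dP|intros; apply Pc|].
  rewrite E; apply Rmult_le_compat_r; [lra | apply fl]. }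
assert (inv : forall t, { x | P x = t }).
{ intros t.
  set (M := Rabs t / c + 1).
  assert (T0 := Rabs_pos t).
  assert (0 <= Rabs t / c) by (apply Rdiv_le_0_compat; lra).
  assert (cM : c * M = Rabs t + c) by (unfold M; field; lra).
  assert (u := grow 0 M ltac:(unfold M; lra)).
  assert (l := grow (- M) 0 ltac:(unfold M; lra)).
  assert (t <= Rabs t) by apply Rle_abs.
  assert (- t <= Rabs t) by (rewrite <- Rabs_Ropp; apply Rle_abs).
  destruct (IVT (fun x => P x - t) (- M) M) as [x [_ Hx]].
  - intros x; apply (continuity_pt_minus P (fct_cte t)); [apply Pc|].
    apply continuity_pt_const; now intros ? ?.
  - unfold M; lra.
  - lra.
  - lra.
  - exists x; lra. }
set (g := fun t => proj1_sig (inv t)).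
assert (Pg : forall t, P (g t) = t) by (intros t; exact (proj2_sig (inv t))).
assert (Pinj : forall x y, P x = P y -> x = y).
{ intros x y E; destruct (Rtotal_order x y) as [L|[->|L]]; [|reflexivity|].
  - specialize (grow x y ltac:(lra)); nra.
  - specialize (grow y x ltac:(lra)); nra. }
assert (lip : forall t t', c * Rabs (g t - g t') <= Rabs (t - t')).
{ intros t t'; rewrite <- (Pg t) at 2; rewrite <- (Pg t') at 2.
  destruct (Rle_lt_dec (g t) (g t')) as [L|L].
  - assert (w := grow _ _ L); rewrite Rabs_left1, Rabs_left1 by nra; nra.
  - assert (w := grow (g t') (g t) ltac:(lra)).
    rewrite Rabs_pos_eq, Rabs_pos_eq by nra; nra. }
exists g; split; [exact Pg|]; split.
{ intros x; apply Pinj, Pg. }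
intros t; apply is_derive_Reals; intros e e0.
assert (fpos : 0 < f (g t)) by (specialize (fl (g t)); lra).
(* the difference quotient of [g] is the inverse of that of [P] *)
assert (q : filterlim (fun y => (P y - P (g t)) / (y - g t)) (locally' (g t))
              (locally (f (g t)))).
{ intros V [eps HV].
  assert (D := dP (g t)); apply is_derive_Reals in D.
  destruct (D eps (cond_pos eps)) as [d Hd].
  exists d; refine (fun (y : R) By Ny => HV _ _).
  specialize (Hd (y - g t) ltac:(lra)).
  replace (g t + (y - g t)) with y in Hd by ring.
  apply Hd, By. }
assert (qi : filterlim (fun y => / ((P y - P (g t)) / (y - g t)))
               (locally' (g t)) (locally (/ f (g t)))).
{ eapply filterlim_comp; [exact q|].
  apply (filterlim_Rbar_inv (f (g t))); intros E; injection E; lra. }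
destruct (qi (ball (/ f (g t)) (mkposreal e e0))) as [d Hd];
  [apply locally_ball|].
assert (cd : 0 < c * d) by (apply Rmult_lt_0_compat; [lra | apply cond_pos]).
exists (mkposreal _ cd); simpl; intros k k0 kd.
assert (gne : g (t + k) <> g t).
{ intros E; apply k0; apply (f_equal P) in E; rewrite !Pg in E; lra. }
assert (gb : Rabs (g (t + k) - g t) < d).
{ specialize (lip (t + k) t); replace (t + k - t) with k in lip by ring.
  apply (Rmult_lt_reg_l c); lra. }
specialize (Hd (g (t + k)) gb gne).
rewrite !Pg in Hd.
replace (/ ((t + k - t) / (g (t + k) - g t))) with ((g (t + k) - g t) / k) in Hd
  by (field; repeat split; lra).
exact Hd.
Qed.

(** * Uniformization of the orbits *)

(* With [z = c - 1], where [c] is the largest root of [U_K], one has [4 K = z^2 (1 + z)] and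
   [a], [b] are the roots of [y^2 - (1 - z) y + z^2].  The Moebius map [y = orb_A z X] sends
   [X = 1, -1, 1/k, -1/k] to [a, b, 0, c] for some [k < 1].  On the orbit
   [X = cos th], and [th] has velocity [speed z th] in the time [2 beta x]. *)
Definition orb_s (z : R) : R := sqrt (z * (2 + 3 * z)).
Definition orb_n (z : R) : R := sqrt ((1 - orb_s z) / (1 + orb_s z)).
Definition orb_K (z : R) : R := z ^ 2 * (1 + z) / 4.
Definition speed2 (z X : R) : R :=
  ((1 - 3 * z ^ 2 + 2 * z * orb_s z) * (1 - X ^ 2) + 4 * z * orb_s z * X ^ 2) / 16.
Definition speed (z th : R) : R := sqrt (speed2 z (cos th)).
Definition orb_A (z X : R) : R :=
  (orb_s z * (1 - orb_n z * X) / (1 + orb_n z * X) - z) / 2.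
(* The value of [A (C - B)] on the orbit when [X = cos th] and [W = speed z th * sin th]. *)
Definition orb_E (z X W : R) : R :=
  2 * orb_s z * orb_n z * W / (1 + orb_n z * X) ^ 2.

Lemma orb_s_spec (z : R) : 0 < z < / 3 ->
  0 < orb_s z < 1 /\ orb_s z ^ 2 = z * (2 + 3 * z).
Proof.
intros Hz; unfold orb_s.
assert (P : 0 < z * (2 + 3 * z)) by nra.
assert (S := sqrt_lt_R0 _ P).
assert (Q : sqrt (z * (2 + 3 * z)) ^ 2 = z * (2 + 3 * z)) by (rewrite pow2_sqrt; lra).
split; [|exact Q].
split; [exact S|].
apply Rnot_le_lt; intros N.
assert (z * (2 + 3 * z) < 1) by nra; nra.
Qed.

Lemma orb_n_spec (z : R) : 0 < z < / 3 ->
  0 < orb_n z < 1 /\ orb_n z ^ 2 = (1 - orb_s z) / (1 + orb_s z).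
Proof.
intros Hz; destruct (orb_s_spec z Hz) as [Hs _]; unfold orb_n.
assert (P : 0 < (1 - orb_s z) / (1 + orb_s z)) by (apply Rdiv_lt_0_compat; lra).
assert (S := sqrt_lt_R0 _ P).
assert (Q := pow2_sqrt _ (Rlt_le _ _ P)).
split; [|exact Q].
split; [exact S|].
assert ((1 - orb_s z) / (1 + orb_s z) < 1).
{ apply (Rmult_lt_reg_r (1 + orb_s z)); [lra|].
  unfold Rdiv; rewrite Rmult_assoc, Rinv_l; lra. }
nra.
Qed.

Lemma orb_den (z X : R) : 0 < z < / 3 -> X ^ 2 <= 1 -> 0 < 1 + orb_n z * X.
Proof. intros Hz HX; destruct (orb_n_spec z Hz) as [Hn _]; nra. Qed.

(** In this form [speed2] is, up to a factor, what the second quadratic of [orb_energy_A] becomes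
    under the Moebius map. *)
Lemma speed2_factor (z X : R) : 0 < z < / 3 ->
  16 * speed2 z X =
  (1 + orb_s z) * (1 + 2 * z - orb_s z) - (1 - orb_s z) * (1 + 2 * z + orb_s z) * X ^ 2.
Proof. intros Hz; destruct (orb_s_spec z Hz) as [_ Q]; unfold speed2; nra. Qed.

Lemma speed2_mono (z w X : R) : 0 < z <= w -> w < / 3 -> X ^ 2 <= 1 ->
  speed2 z X <= speed2 w X.
Proof.
intros Hz Hw HX.
destruct (orb_s_spec z ltac:(lra)) as [Hs Qs].
destruct (orb_s_spec w ltac:(lra)) as [Ht Qt].
unfold speed2; set (s := orb_s z) in *; set (t := orb_s w) in *.
assert (X2 := pow2_ge_0 X).
assert (st : s <= t) by nra.
assert (zs : z * s <= w * t) by nra.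
assert (M : 1 - 3 * z ^ 2 + 2 * z * s <= 1 - 3 * w ^ 2 + 2 * w * t).
(* For positive [z] this inequality amounts to [z <= 1/3]. It lets the growth of [2 z s] outweigh
   the decreasing term [- 3 z^2]. *)
{ assert (3 * z <= s) by nra.
  assert (3 * w <= t) by nra.
  nra. }
nra.
Qed.

Lemma speed2_pos (z X : R) : 0 < z < / 3 -> X ^ 2 <= 1 ->
  z * orb_s z / 4 <= speed2 z X.
Proof.
intros Hz HX.
destruct (orb_s_spec z Hz) as [Hs Qs].
unfold speed2; set (s := orb_s z) in *.
assert (X2 := pow2_ge_0 X).
assert (4 * z * s <= 1 - 3 * z ^ 2 + 2 * z * s) by nra.
nra.
Qed.

(** Origin of [orb_s]: in the variable [Y = 2 A + z] both pairs of roots, [{a, b}] and [{0, c}],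
    have the product [orb_s z ^ 2]. The involution [Y -> s^2 / Y] thus swaps each pair, and the
    Moebius map turns it into [X -> - X]. *)
Lemma orb_energy_A (z Y : R) : 0 < z < / 3 ->
  16 * ((Y - z) / 2 * ((Y - z) / 2 * (1 - (Y - z) / 2) ^ 2 - 4 * orb_K z)) =
  (Y ^ 2 - 2 * Y + orb_s z ^ 2) * (Y ^ 2 - (2 + 4 * z) * Y + orb_s z ^ 2).
Proof.
intros Hz; destruct (orb_s_spec z Hz) as [_ Q]; rewrite Q; unfold orb_K; field.
Qed.

(** The right side is [(A (C - B))^2], because [(C - B)^2 = (1 - A)^2 - 4 B C]. The value of [orb_n]
    makes the first quadratic proportional to [1 - X^2]; the second one yields [speed2]. *)
Lemma orb_energy (z X W : R) : 0 < z < / 3 -> X ^ 2 <= 1 ->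
  W ^ 2 = (1 - X ^ 2) * speed2 z X ->
  orb_E z X W ^ 2 =
  orb_A z X ^ 2 * (1 - orb_A z X) ^ 2 - 4 * orb_K z * orb_A z X.
Proof.
intros Hz HX HW.
destruct (orb_s_spec z Hz) as [Hs Qs], (orb_n_spec z Hz) as [Hn Qn].
assert (D := orb_den z X Hz HX).
assert (HF := speed2_factor z X Hz).
unfold orb_E, orb_A.
set (Y := orb_s z * (1 - orb_n z * X) / (1 + orb_n z * X)).
apply Rmult_eq_reg_l with 16; [|lra].
transitivity ((Y ^ 2 - 2 * Y + orb_s z ^ 2) * (Y ^ 2 - (2 + 4 * z) * Y + orb_s z ^ 2));
  [|rewrite <- (orb_energy_A z Y Hz); ring].
set (s := orb_s z) in *; set (n := orb_n z) in *.
replace (16 * (2 * s * n * W / (1 + n * X) ^ 2) ^ 2)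
  with (4 * s ^ 2 * n ^ 2 * (1 - X ^ 2) * (16 * speed2 z X) / (1 + n * X) ^ 4).
2:{ replace ((2 * s * n * W / (1 + n * X) ^ 2) ^ 2)
      with (4 * s ^ 2 * n ^ 2 * W ^ 2 / (1 + n * X) ^ 4) by (field; lra).
    rewrite HW; field; lra. }
rewrite HF.
assert (E1 : Y ^ 2 - 2 * Y + s ^ 2 = - 2 * s * ((1 - s) - (1 + s) * (n ^ 2 * X ^ 2)) / (1 + n * X) ^ 2)
  by (unfold Y; field; lra).
assert (E2 : Y ^ 2 - (2 + 4 * z) * Y + s ^ 2 =
  - 2 * s * ((1 + 2 * z - s) - (1 + 2 * z + s) * (n ^ 2 * X ^ 2)) / (1 + n * X) ^ 2)
  by (unfold Y; field; lra).
rewrite E1, E2, Qn; field; lra.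
Qed.

(** The sign of the first quadratic gives [Y <= 2], hence [A < 1]; that of the second puts [Y]
    between its roots [z] and [2 + 3 z], hence [0 < A]. *)
Lemma orb_A_range (z X : R) : 0 < z < / 3 -> X ^ 2 <= 1 -> 0 < orb_A z X < 1.
Proof.
intros Hz HX.
destruct (orb_s_spec z Hz) as [Hs Qs], (orb_n_spec z Hz) as [Hn Qn].
assert (D := orb_den z X Hz HX).
assert (D' : 0 < 1 - orb_n z * X) by nra.
unfold orb_A.
set (Y := orb_s z * (1 - orb_n z * X) / (1 + orb_n z * X)).
assert (Y0 : 0 < Y) by (apply Rdiv_lt_0_compat; nra).
set (s := orb_s z) in *; set (n := orb_n z) in *.
assert (P2 : 0 < (1 + n * X) ^ 2) by (apply pow_lt; lra).
assert (E1 : Y ^ 2 - 2 * Y + s ^ 2 = - (2 * s * ((1 - s) - (1 + s) * (n ^ 2 * X ^ 2))) / (1 + n * X) ^ 2)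
  by (unfold Y; field; lra).
assert (E2 : Y ^ 2 - (2 + 4 * z) * Y + s ^ 2 =
  - (2 * s * ((1 + 2 * z - s) - (1 + 2 * z + s) * (n ^ 2 * X ^ 2))) / (1 + n * X) ^ 2)
  by (unfold Y; field; lra).
assert (R2 : (1 + s) * (n ^ 2 * X ^ 2) = (1 - s) * X ^ 2) by (rewrite Qn; field; lra).
assert (Y ^ 2 - 2 * Y + s ^ 2 <= 0).
{ rewrite E1, R2; unfold Rdiv; rewrite <- Ropp_mult_distr_l.
  apply Ropp_le_cancel; rewrite Ropp_involutive, Ropp_0.
  apply Rmult_le_pos; [|left; apply Rinv_0_lt_compat, P2].
  apply Rmult_le_pos; [lra|].
  replace (1 - s - (1 - s) * X ^ 2) with ((1 - s) * (1 - X ^ 2)) by ring.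
  apply Rmult_le_pos; lra. }
assert (Y ^ 2 - (2 + 4 * z) * Y + s ^ 2 < 0).
{ rewrite E2; unfold Rdiv; rewrite <- Ropp_mult_distr_l.
  apply Ropp_lt_cancel; rewrite Ropp_involutive, Ropp_0.
  assert (0 <= n ^ 2 * X ^ 2) by (apply Rmult_le_pos; apply pow2_ge_0).
  apply Rmult_lt_0_compat; [|apply Rinv_0_lt_compat, P2].
  apply Rmult_lt_0_compat; [lra|].
  assert ((1 + s) * (n ^ 2 * X ^ 2) <= 1 - s) by (rewrite R2; nra).
  assert (n ^ 2 * X ^ 2 <= 1 - s) by nra.
  nra. }
split; [|nra].
assert (z < Y); [|lra].
apply Rnot_le_lt; intros N.
assert (E : Y ^ 2 - (2 + 4 * z) * Y + s ^ 2 = (Y - z) * (Y - 2 - 3 * z)) by (rewrite Qs; ring).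
nra.
Qed.

(** The left side is [2 * speed] times the phase derivative of [orb_E]. Differentiating [orb_energy]
    would require division by [orb_E], which vanishes at the turning points; a rational identity
    avoids this. *)
Lemma orb_E_deriv (z X : R) : 0 < z < / 3 -> X ^ 2 <= 1 ->
  2 * orb_s z * orb_n z *
   (2 * X * (speed2 z X
       + (1 - X ^ 2) * (1 - orb_s z) * (1 + 2 * z + orb_s z) / 16) / (1 + orb_n z * X) ^ 2
    + 4 * orb_n z * ((1 - X ^ 2) * speed2 z X) / (1 + orb_n z * X) ^ 3) =
  orb_A z X * (1 - orb_A z X) * (1 - 2 * orb_A z X) - 2 * orb_K z.
Proof.
intros Hz HX.
destruct (orb_s_spec z Hz) as [Hs Qs], (orb_n_spec z Hz) as [Hn Qn].
assert (D := orb_den z X Hz HX).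
assert (HF := speed2_factor z X Hz).
unfold orb_A.
set (Y := orb_s z * (1 - orb_n z * X) / (1 + orb_n z * X)).
set (s := orb_s z) in *; set (n := orb_n z) in *.
set (r := n * X) in *.
assert (X2 : X ^ 2 = (1 + s) / (1 - s) * r ^ 2).
{ unfold r; rewrite Rpow_mult_distr, Qn; field; lra. }
assert (G : 16 * ((Y - z) / 2 * (1 - (Y - z) / 2) * (1 - 2 * ((Y - z) / 2)) - 2 * orb_K z)
  = (2 * Y - 2) * (Y ^ 2 - (2 + 4 * z) * Y + s ^ 2)
    + (2 * Y - 2 - 4 * z) * (Y ^ 2 - 2 * Y + s ^ 2)).
{ rewrite Qs; unfold orb_K; field. }
apply Rmult_eq_reg_l with 16; [|lra]; rewrite G.
replace (speed2 z X) with ((16 * speed2 z X) / 16) by field.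
rewrite HF.
transitivity (2 * s * (2 * r * (((1 + s) * (1 + 2 * z - s) - (1 - s) * (1 + 2 * z + s) * X ^ 2)
   + (1 - X ^ 2) * (1 - s) * (1 + 2 * z + s)) / (1 + r) ^ 2
   + 4 * n ^ 2 * ((1 - X ^ 2) * ((1 + s) * (1 + 2 * z - s) - (1 - s) * (1 + 2 * z + s) * X ^ 2)) / (1 + r) ^ 3)).
{ unfold r; field; unfold r in D; lra. }
rewrite X2, Qn; unfold Y; field; lra.
Qed.

(** * Global solutions *)

(** Half of a turn in the time [2 beta x]; the period in [x] is therefore [half_period z / beta]. *)
Definition half_period (z : R) : R := RInt (fun th => / speed z th) 0 PI.

(** Two-sided derivatives on the whole line, since orbits are followed beyond time 1. *)
Definition LV (beta : R) (A B C : R -> R) : Prop :=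
  forall x, 0 < A x /\ 0 < B x /\ 0 < C x /\ A x + B x + C x = 1 /\
    is_derive A x (beta * A x * (C x - B x)) /\
    is_derive B x (beta * B x * (A x - C x)) /\
    is_derive C x (beta * C x * (B x - A x)).

Lemma cos2_le_1 (th : R) : cos th ^ 2 <= 1.
Proof. assert (H := sin2_cos2 th); unfold Rsqr in H; nra. Qed.

Lemma speed_pos (z th : R) : 0 < z < / 3 -> 0 < speed2 z (cos th) /\ 0 < speed z th.
Proof.
intros Hz.
destruct (orb_s_spec z Hz) as [Hs _].
assert (P := speed2_pos z _ Hz (cos2_le_1 th)).
assert (0 < speed2 z (cos th)) by nra.
split; [assumption | now apply sqrt_lt_R0].
Qed.

Lemma speed_sqr (z th : R) : 0 < z < / 3 -> speed z th ^ 2 = speed2 z (cos th).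
Proof.
intros Hz; destruct (speed_pos z th Hz) as [P _].
unfold speed; apply pow2_sqrt; lra.
Qed.

Lemma speed_le_1 (z th : R) : 0 < z < / 3 -> speed z th <= 1.
Proof.
intros Hz; destruct (speed_pos z th Hz) as [P Q].
assert (E := speed_sqr z th Hz).
destruct (orb_s_spec z Hz) as [Hs _].
assert (C := cos2_le_1 th); assert (C' := pow2_ge_0 (cos th)).
unfold speed2 in E.
assert (z * orb_s z < 1) by nra.
assert (0 < z * orb_s z) by nra.
assert (speed z th ^ 2 <= 1) by nra.
nra.
Qed.

Lemma speed_continuous (z th : R) : 0 < z < / 3 -> continuous (speed z) th.
Proof.
intros Hz; destruct (speed_pos z th Hz) as [P _].
apply (ex_derive_continuous (speed z)).
unfold speed, speed2 in *; auto_derive; lra.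
Qed.

Lemma inv_speed_continuous (z th : R) : 0 < z < / 3 ->
  continuous (fun t => / speed z t) th.
Proof.
intros Hz; apply continuous_Rinv_comp; [now apply speed_continuous|].
destruct (speed_pos z th Hz) as [_ P]; lra.
Qed.

Lemma inv_speed_ge_1 (z th : R) : 0 < z < / 3 -> 1 <= / speed z th.
Proof.
intros Hz; destruct (speed_pos z th Hz) as [_ P].
rewrite <- Rinv_1; apply Rinv_le_contravar; [exact P | now apply speed_le_1].
Qed.

Lemma ex_RInt_inv_speed (z a b : R) : 0 < z < / 3 ->
  ex_RInt (fun t => / speed z t) a b.
Proof.
intros Hz; apply (ex_RInt_continuous (V := R_CompleteNormedModule)).
intros; now apply inv_speed_continuous.
Qed.

Lemma is_derive_phase_time (z th : R) : 0 < z < / 3 ->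
  is_derive (RInt (fun t => / speed z t) 0) th (/ speed z th).
Proof.
intros Hz.
apply (is_derive_RInt (fun t => / speed z t) (RInt (fun t => / speed z t) 0) 0 th);
  [|now apply inv_speed_continuous].
exists (mkposreal 1 Rlt_0_1); intros y _.
apply (@RInt_correct R_CompleteNormedModule), ex_RInt_inv_speed, Hz.
Qed.

Lemma half_period_mono (z w : R) : 0 < z <= w -> w < / 3 ->
  half_period w <= half_period z.
Proof.
intros Hz Hw; apply RInt_le.
- left; apply PI_RGT_0.
- apply ex_RInt_inv_speed; lra.
- apply ex_RInt_inv_speed; lra.
- intros th _; destruct (speed_pos z th ltac:(lra)) as [P Q].
  apply Rinv_le_contravar; [exact Q|].
  apply sqrt_le_1_alt, speed2_mono; try lra; apply cos2_le_1.
Qed.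

(** The speed depends on [cos th] only through its square, hence has period [PI], so the increment
    does not depend on [th]. *)
Lemma phase_time_PI (z th : R) : 0 < z < / 3 ->
  RInt (fun t => / speed z t) 0 (th + PI) =
  RInt (fun t => / speed z t) 0 th + half_period z.
Proof.
intros Hz; set (P := RInt (fun t => / speed z t) 0).
assert (E : P (th + PI) - P th = P (0 + PI) - P 0).
{ apply (derive_zero_const (fun t => P (t + PI) - P t)); intros t.
  replace 0 with (1 * / speed z (t + PI) - / speed z t).
  2:{ unfold speed; rewrite neg_cos.
      replace (speed2 z (- cos t)) with (speed2 z (cos t)) by (unfold speed2; field).
      ring. }
  apply (is_derive_minus (fun t => P (t + PI))); [|now apply is_derive_phase_time].
  apply (is_derive_comp P (fun t => t + PI)); [now apply is_derive_phase_time|].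
  auto_derive; [exact I | ring]. }
rewrite Rplus_0_l in E.
unfold half_period; fold P.
replace (P 0) with 0 in E; [lra|].
symmetry; apply (@RInt_point R_CompleteNormedModule).
Qed.

Lemma orb_A_deriv (z X : R) : 0 < z < / 3 -> X ^ 2 <= 1 ->
  is_derive (orb_A z) X (- orb_s z * orb_n z / (1 + orb_n z * X) ^ 2).
Proof.
intros Hz HX; assert (D := orb_den z X Hz HX).
unfold orb_A; auto_derive; [lra|]; field; lra.
Qed.

Lemma orb_A_decr (z X X' : R) : 0 < z < / 3 -> X ^ 2 <= 1 -> X' ^ 2 <= 1 ->
  X < X' -> orb_A z X' < orb_A z X.
Proof.
intros Hz HX HX' L.
assert (D := orb_den z X Hz HX); assert (D' := orb_den z X' Hz HX').
destruct (orb_s_spec z Hz) as [Hs _], (orb_n_spec z Hz) as [Hn _].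
apply Rminus_lt_0; unfold orb_A.
replace (_ - _) with (orb_s z * orb_n z * (X' - X) / ((1 + orb_n z * X) * (1 + orb_n z * X')))
  by (field; lra).
apply Rdiv_lt_0_compat; repeat apply Rmult_lt_0_compat; lra.
Qed.

Lemma orb_A_inj (z X X' : R) : 0 < z < / 3 -> X ^ 2 <= 1 -> X' ^ 2 <= 1 ->
  orb_A z X = orb_A z X' -> X = X'.
Proof.
intros Hz HX HX' E.
destruct (Rtotal_order X X') as [L|[L|L]]; [|exact L|].
- assert (H := orb_A_decr z X X' Hz HX HX' L); lra.
- assert (H := orb_A_decr z X' X Hz HX' HX L); lra.
Qed.

Lemma pow2_le_1 (x : R) : x ^ 2 <= 1 -> -1 <= x <= 1.
Proof. intros H; split; nra. Qed.

Lemma phase_exists (z A B C : R) : 0 < z < / 3 ->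
  0 < A -> 0 < B -> 0 < C -> A + B + C = 1 -> A * B * C = orb_K z ->
  exists th, orb_A z (cos th) = A /\
    orb_E z (cos th) (speed z th * sin th) = A * (C - B).
Proof.
intros Hz HA HB HC S HK.
destruct (orb_s_spec z Hz) as [Hs Qs], (orb_n_spec z Hz) as [Hn Qn].
assert (HF := orb_energy_A z (2 * A + z) Hz).
replace ((2 * A + z - z) / 2) with A in HF by field.
set (Y := 2 * A + z) in *; set (s := orb_s z) in *; set (n := orb_n z) in *.
assert (E : A * (A * (1 - A) ^ 2 - 4 * orb_K z) = (A * (C - B)) ^ 2)
  by (rewrite <- HK; replace (1 - A) with (B + C) by lra; ring).
rewrite E in HF.
assert (Q2 : Y ^ 2 - (2 + 4 * z) * Y + s ^ 2 < 0).
{ replace (Y ^ 2 - (2 + 4 * z) * Y + s ^ 2) with ((Y - z) * (Y - 2 - 3 * z))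
    by (rewrite Qs; ring).
  unfold Y; nra. }
assert (Q1 : Y ^ 2 - 2 * Y + s ^ 2 <= 0).
{ assert (H := pow2_ge_0 (A * (C - B))); nra. }
assert (Y0 : 0 < Y) by (unfold Y; lra).
(* Inverse of the Moebius map; [X^2 <= 1] is equivalent to the first quadratic being nonpositive. *)
set (X := (s - Y) / (n * (s + Y))).
assert (X2 : X ^ 2 <= 1).
{ replace (X ^ 2) with ((s - Y) ^ 2 / (n ^ 2 * (s + Y) ^ 2)) by (unfold X; field; lra).
  rewrite Qn.
  replace ((s - Y) ^ 2 / ((1 - s) / (1 + s) * (s + Y) ^ 2))
    with ((1 + s) * (s - Y) ^ 2 * / ((1 - s) * (s + Y) ^ 2)) by (field; lra).
  assert (0 < (1 - s) * (s + Y) ^ 2) by (apply Rmult_lt_0_compat; [lra | apply pow_lt; lra]).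
  apply (Rmult_le_reg_r ((1 - s) * (s + Y) ^ 2)); [assumption|].
  rewrite Rmult_assoc, Rinv_l by lra.
  assert (0 <= s * - (Y ^ 2 - 2 * Y + s ^ 2)) by (apply Rmult_le_pos; lra).
  nra. }
assert (HX : -1 <= X <= 1) by now apply pow2_le_1.
assert (AX : orb_A z X = A).
{ unfold orb_A; fold s n; unfold X.
  replace A with ((Y - z) / 2) by (unfold Y; field).
  replace (1 - n * ((s - Y) / (n * (s + Y)))) with (2 * Y / (s + Y)) by (field; lra).
  replace (1 + n * ((s - Y) / (n * (s + Y)))) with (2 * s / (s + Y)) by (field; lra).
  field; lra. }
assert (CX := cos_acos X HX).
assert (Esq : forall th, cos th = X ->
  orb_E z (cos th) (speed z th * sin th) ^ 2 = (A * (C - B)) ^ 2).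
{ intros th Hth.
  rewrite (orb_energy z (cos th)); [| exact Hz | apply cos2_le_1 |].
  - rewrite Hth, AX, <- E; ring.
  - rewrite Rpow_mult_distr, speed_sqr by exact Hz.
    assert (T := sin2_cos2 th); unfold Rsqr in T.
    replace (sin th ^ 2) with (1 - cos th ^ 2) by lra; ring. }
assert (G := Esq _ CX).
assert (G' : (orb_E z (cos (acos X)) (speed z (acos X) * sin (acos X)) - A * (C - B)) *
  (orb_E z (cos (acos X)) (speed z (acos X) * sin (acos X)) + A * (C - B)) = 0) by lra.
(* The energy fixes [A (C - B)] up to sign, and reversing the phase changes that sign while keeping
   [A]. *)
apply Rmult_integral in G' as [G'|G'].
- exists (acos X); rewrite CX in *; split; [exact AX | lra].
- exists (- acos X).
  unfold speed in *; rewrite cos_neg, sin_neg, CX in *; split; [exact AX|].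
  unfold orb_E in *.
  replace (2 * orb_s z * orb_n z * (sqrt (speed2 z X) * - sin (acos X)) / (1 + orb_n z * X) ^ 2)
   with (- (2 * orb_s z * orb_n z * (sqrt (speed2 z X) * sin (acos X)) / (1 + orb_n z * X) ^ 2)).
  + lra.
  + assert (D := orb_den z X Hz X2); field; lra.
Qed.

Lemma cos_eq_1_small (d : R) : - (2 * PI) < d < 2 * PI -> cos d = 1 -> d = 0.
Proof.
intros Hd E.
replace d with (2 * (d / 2)) in E by field.
rewrite cos_2a_sin in E.
assert (S : sin (d / 2) = 0) by nra.
destruct (Rtotal_order d 0) as [N|[|N]]; [exfalso|assumption|exfalso].
- assert (0 < sin (- (d / 2))) by (apply sin_gt_0; lra).
  rewrite sin_neg in H; lra.
- assert (0 < sin (d / 2)) by (apply sin_gt_0; lra); lra.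
Qed.

Lemma orb_E_phase_deriv (z th : R) : 0 < z < / 3 ->
  is_derive (fun t => orb_E z (cos t) (speed z t * sin t)) th
   ((orb_A z (cos th) * (1 - orb_A z (cos th)) * (1 - 2 * orb_A z (cos th))
      - 2 * orb_K z) / (2 * speed z th)).
Proof.
intros Hz.
destruct (speed_pos z th Hz) as [P Q].
assert (D := orb_den z _ Hz (cos2_le_1 th)).
rewrite <- (orb_E_deriv z _ Hz (cos2_le_1 th)).
rewrite <- (speed_sqr z th Hz).
assert (SC := sin2_cos2 th); unfold Rsqr in SC.
assert (dF : is_derive (speed z) th
  (cos th * sin th * ((1 - orb_s z) * (1 + 2 * z + orb_s z)) / (16 * speed z th))).
{ destruct (orb_s_spec z Hz) as [_ Qs].
  unfold speed, speed2 in *; auto_derive; [lra|].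
  match goal with |- _ = _ / (16 * sqrt ?u) =>
    match goal with |- context [/ (2 * sqrt ?v)] => replace v with u by (simpl; field) end end.
  replace ((1 - orb_s z) * (1 + 2 * z + orb_s z))
    with (1 - 3 * z ^ 2 - 2 * z * orb_s z) by nra.
  field; lra. }
unfold orb_E.
auto_derive.
- split; [eexists; exact dF|]; split; [|exact I]. apply Rgt_not_eq; simpl; nra.
- assert (eF : Derive (fun t : R => speed z t) th = _) by exact (is_derive_unique _ _ _ dF).
  rewrite eF.
  replace (1 - cos th ^ 2) with (sin th * sin th) by lra.
  field; split; lra.
Qed.

Lemma orbit_exists (beta z A0 B0 C0 : R) : 0 < beta -> 0 < z < / 3 ->
  0 < A0 -> 0 < B0 -> 0 < C0 -> A0 + B0 + C0 = 1 -> A0 * B0 * C0 = orb_K z ->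
  exists A B C : R -> R, LV beta A B C /\
    (forall x, A x * B x * C x = orb_K z) /\
    (A 0 = A0 /\ B 0 = B0 /\ C 0 = C0) /\
    (A (half_period z / beta) = A0 /\ B (half_period z / beta) = B0 /\
     C (half_period z / beta) = C0) /\
    (forall x y, 0 < x < half_period z / beta -> 0 < y < half_period z / beta ->
      A x = A y -> B x = B y -> C x = C y -> x = y).
Proof.
intros Hb Hz HA HB HC S HK.
destruct (phase_exists z A0 B0 C0 Hz HA HB HC S HK) as [th0 [TA TE]].
set (T := half_period z / beta).
set (P := RInt (fun t => / speed z t) 0).
destruct (inverse_of_integral (fun t => / speed z t) 1 Rlt_0_1
  (fun t => inv_speed_continuous z t Hz) (fun t => inv_speed_ge_1 z t Hz))
  as [g [Pg [gP dg]]]; fold P in Pg, gP.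
(* [P th] is the time needed to reach the phase [th] from 0; the shift by [P th0] starts the motion
   at [th0]. *)
set (psi := fun x => g (2 * beta * x + P th0)).
assert (dpsi : forall x, is_derive psi x (2 * beta * speed z (psi x))).
{ intros x; unfold psi.
  apply (is_derive_comp g (fun x => 2 * beta * x + P th0)).
  - replace (speed z (g (2 * beta * x + P th0)))
      with (/ / speed z (g (2 * beta * x + P th0))) by apply Rinv_inv.
    apply dg.
  - auto_derive; [exact I | ring]. }
assert (psi0 : psi 0 = th0).
{ unfold psi; rewrite Rmult_0_r, Rplus_0_l; apply gP. }
assert (psiT : psi T = th0 + PI + PI).
{ unfold psi; rewrite <- (gP (th0 + PI + PI)); f_equal; unfold P.
  rewrite !phase_time_PI by exact Hz; fold P; unfold T; field; lra. }
set (A := fun x => orb_A z (cos (psi x))).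
set (E := fun x => orb_E z (cos (psi x)) (speed z (psi x) * sin (psi x))).
(* [B] and [C] are recovered from [B + C = 1 - A] and [C - B = E / A]. *)
set (B := fun x => (1 - A x - E x / A x) / 2).
set (C := fun x => (1 - A x + E x / A x) / 2).
assert (rA : forall x, 0 < A x < 1) by (intros x; apply orb_A_range, cos2_le_1; exact Hz).
assert (en : forall x, E x ^ 2 = A x ^ 2 * (1 - A x) ^ 2 - 4 * orb_K z * A x).
{ intros x; apply orb_energy; [exact Hz | apply cos2_le_1|].
  rewrite Rpow_mult_distr, speed_sqr by exact Hz.
  assert (SC := sin2_cos2 (psi x)); unfold Rsqr in SC.
  replace (sin (psi x) ^ 2) with (1 - cos (psi x) ^ 2) by lra; ring. }
assert (K0 : 0 < orb_K z) by (rewrite <- HK; repeat apply Rmult_lt_0_compat; assumption).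
assert (prod : forall x, A x * B x * C x = orb_K z).
{ intros x; specialize (rA x); specialize (en x); unfold B, C.
  replace (A x * ((1 - A x - E x / A x) / 2) * ((1 - A x + E x / A x) / 2))
    with ((A x ^ 2 * (1 - A x) ^ 2 - E x ^ 2) / (4 * A x)) by (field; lra).
  rewrite en; field; lra. }
assert (dA : forall x, is_derive A x (beta * E x)).
{ intros x; unfold A.
  assert (D := orb_den z _ Hz (cos2_le_1 (psi x))).
  replace (beta * E x) with ((2 * beta * speed z (psi x)) * (- sin (psi x) *
    (- orb_s z * orb_n z / (1 + orb_n z * cos (psi x)) ^ 2))).
  2:{ unfold E, orb_E; field; lra. }
  apply (is_derive_comp (fun t => orb_A z (cos t)) psi); [|apply dpsi].
  apply (is_derive_comp (orb_A z) cos); [apply orb_A_deriv, cos2_le_1; exact Hz|].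
  auto_derive; [exact I | ring]. }
assert (dE : forall x, is_derive E x
  (beta * (A x * (1 - A x) * (1 - 2 * A x) - 2 * orb_K z))).
{ intros x; unfold E.
  destruct (speed_pos z (psi x) Hz) as [_ Q].
  replace (beta * (A x * (1 - A x) * (1 - 2 * A x) - 2 * orb_K z))
   with ((2 * beta * speed z (psi x)) *
     ((A x * (1 - A x) * (1 - 2 * A x) - 2 * orb_K z) / (2 * speed z (psi x))))
   by (field; lra).
  apply (is_derive_comp (fun t => orb_E z (cos t) (speed z t * sin t)) psi);
    [now apply orb_E_phase_deriv | apply dpsi]. }
assert (CB : forall x, A x * (C x - B x) = E x).
{ intros x; specialize (rA x); unfold B, C; field; lra. }
assert (sum : forall x, A x + B x + C x = 1) by (intros x; unfold B, C; field; specialize (rA x); lra).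
assert (at_phase : forall x, A x = A0 -> E x = A0 * (C0 - B0) -> B x = B0 /\ C x = C0).
{ intros x H1 H2; unfold B, C; rewrite H1, H2; split;
    replace (A0 * (C0 - B0) / A0) with (C0 - B0) by (field; lra); lra. }
exists A, B, C.
split; [|split; [exact prod|split; [|split]]].
- intros x; specialize (rA x); specialize (prod x); specialize (sum x).
  assert (BC : 0 < B x * C x) by (apply (Rmult_lt_reg_l (A x)); [lra|]; nra).
  assert (0 < B x) by nra.
  assert (0 < C x) by nra.
  split; [lra|]; split; [assumption|]; split; [assumption|]; split; [exact sum|].
  assert (exA : ex_derive A x) by (eexists; apply dA).
  assert (exE : ex_derive E x) by (eexists; apply dE).
  assert (eA : Derive (fun t : R => A t) x = _) by exact (is_derive_unique _ _ _ (dA x)).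
  assert (eE : Derive (fun t : R => E t) x = _) by exact (is_derive_unique _ _ _ (dE x)).
  specialize (en x).
  split; [replace (beta * A x * (C x - B x)) with (beta * E x)
            by (rewrite <- CB; ring); apply dA|].
  split.
  + unfold C, B. auto_derive.
    * repeat split; (assumption || lra).
    * rewrite eA, eE.
      replace (orb_K z) with ((A x ^ 2 * (1 - A x) ^ 2 - E x ^ 2) / (4 * A x))
        by (rewrite en; field; lra).
      field; lra.
  + unfold C, B. auto_derive.
    * repeat split; (assumption || lra).
    * rewrite eA, eE.
      replace (orb_K z) with ((A x ^ 2 * (1 - A x) ^ 2 - E x ^ 2) / (4 * A x))
        by (rewrite en; field; lra).
      field; lra.
- assert (H1 : A 0 = A0) by (unfold A; rewrite psi0; exact TA).
  split; [exact H1|]; apply at_phase; [exact H1|].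
  unfold E; rewrite psi0; exact TE.
- assert (R2 : cos (th0 + PI + PI) = cos th0 /\ sin (th0 + PI + PI) = sin th0)
    by (split; [rewrite !neg_cos | rewrite !neg_sin]; ring).
  destruct R2 as [Rc Rs].
  assert (H1 : A T = A0) by (unfold A; rewrite psiT, Rc; exact TA).
  split; [exact H1|]; apply at_phase; [exact H1|].
  unfold E; rewrite psiT; unfold speed in *; rewrite Rc, Rs; exact TE.
(* In one period the phase grows by [2 PI]. Here [A] determines the cosine of the phase and
   [A (C - B)] its sine, so equal states within the open period have equal phases. *)
- fold T; intros x y Hx Hy EA EB EC.
  assert (mono : forall u v, u < v -> psi u < psi v).
  { intros u v uv; apply (derive_pos_incr _ _ u v uv dpsi); intros t _.
    destruct (speed_pos z (psi t) Hz) as [_ Q].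
    apply Rmult_lt_0_compat; lra. }
  assert (X1 := mono 0 x ltac:(lra)); assert (X2 := mono x T ltac:(lra)).
  assert (Y1 := mono 0 y ltac:(lra)); assert (Y2 := mono y T ltac:(lra)).
  rewrite psi0 in X1, Y1; rewrite psiT in X2, Y2.
  assert (Ec : cos (psi x) = cos (psi y))
    by (apply (orb_A_inj z); try apply cos2_le_1; assumption).
  assert (EE : E x = E y) by (rewrite <- !CB, EA, EB, EC; reflexivity).
  assert (Es : sin (psi x) = sin (psi y)).
  { unfold E, orb_E, speed in EE; rewrite Ec in EE.
    destruct (speed_pos z (psi y) Hz) as [_ Q]; unfold speed in Q.
    assert (D := orb_den z _ Hz (cos2_le_1 (psi y))).
    destruct (orb_s_spec z Hz) as [Hs _], (orb_n_spec z Hz) as [Hn _].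
    set (k := 2 * orb_s z * orb_n z * sqrt (speed2 z (cos (psi y)))
               / (1 + orb_n z * cos (psi y)) ^ 2).
    assert (k0 : 0 < k).
    { apply Rdiv_lt_0_compat; [|apply pow_lt, D].
      repeat apply Rmult_lt_0_compat; lra. }
    apply (Rmult_eq_reg_l k); [|lra].
    unfold k; etransitivity; [etransitivity; [|exact EE]|]; field; lra. }
  assert (Ep : psi x - psi y = 0).
  { apply cos_eq_1_small; [lra|].
    rewrite cos_minus, Ec, Es.
    assert (SC := sin2_cos2 (psi y)); unfold Rsqr in SC; lra. }
  assert (Ep' : psi x = psi y) by lra.
  unfold psi in Ep'; apply (f_equal P) in Ep'; rewrite !Pg in Ep'.
  nra.
Qed.

(** * The period as an improper integral *)

Lemma cubic_factor (a z : R) : a < 1 + z -> a * (1 - a) ^ 2 = z ^ 2 * (1 + z) ->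
  a ^ 2 - (1 - z) * a + z ^ 2 = 0.
Proof.
intros H E.
assert (P : (a - (1 + z)) * (a ^ 2 - (1 - z) * a + z ^ 2) = 0)
  by (transitivity (a * (1 - a) ^ 2 - z ^ 2 * (1 + z)); [ring | lra]).
apply Rmult_integral in P as [|]; lra.
Qed.

Lemma U_K_root (K y : R) : y <> 0 -> U_K K y = 0 -> y * (1 - y) ^ 2 = 4 * K.
Proof.
unfold U_K; intros Hy E.
assert (P : y * (y * (1 - y) ^ 2 - 4 * K) = 0) by lra.
apply Rmult_integral in P as [|]; lra.
Qed.

Lemma U_K_roots_param (K a b c : R) :
  0 < a -> a < b -> b < 1 -> 1 < c -> U_K K a = 0 -> U_K K b = 0 -> U_K K c = 0 ->
  exists z, 0 < z < / 3 /\ K = orb_K z /\ a = orb_A z 1 /\ b = orb_A z (-1).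
Proof.
intros Ha ab Hb Hc Ea Eb Ec.
apply U_K_root in Ea, Eb, Ec; try lra.
set (z := c - 1).
assert (EK : 4 * K = z ^ 2 * (1 + z)) by (rewrite <- Ec; unfold z; ring).
rewrite EK in Ea, Eb.
apply cubic_factor in Ea, Eb; try (unfold z; lra).
assert (S : a + b = 1 - z).
{ assert (P : (a - b) * (a + b - (1 - z)) = 0) by lra.
  apply Rmult_integral in P as [|]; lra. }
assert (z0 : 0 < z) by (unfold z; lra).
assert (z3 : z < / 3).
(* From [a + b = 1 - z], [a * b = z^2] and [a <> b] follows [2 z < 1 - z]. *)
{ assert (a * b = z ^ 2) by nra.
  assert (0 < (b - a) * (b - a)) by nra.
  nra. }
assert (Hz : 0 < z < / 3) by lra.
exists z; split; [exact Hz|]; split; [unfold orb_K; lra|].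
(* At [X = 1] and [X = -1] the energy vanishes, so [orb_A] is a root, and its range excludes 0 and
   [c]. Monotonicity then decides which root it is. *)
assert (one : forall X, X ^ 2 = 1 -> orb_A z X = a \/ orb_A z X = b).
{ intros X HX.
  destruct (orb_A_range z X Hz ltac:(lra)) as [A0 A1].
  assert (En := orb_energy z X 0 Hz ltac:(lra) ltac:(rewrite HX; ring)).
  unfold orb_E in En; rewrite Rmult_0_r in En; unfold Rdiv in En; rewrite Rmult_0_l in En.
  assert (P : orb_A z X * (orb_A z X * (1 - orb_A z X) ^ 2 - 4 * orb_K z) = 0) by lra.
  apply Rmult_integral in P as [|P]; [lra|].
  assert (Q := cubic_factor (orb_A z X) z ltac:(lra) ltac:(unfold orb_K in P; lra)).
  assert (P' : (orb_A z X - a) * (orb_A z X - b) = 0).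
  { replace b with (1 - z - a) by lra. nra. }
  apply Rmult_integral in P' as [|]; [left | right]; lra. }
assert (D := orb_A_decr z (-1) 1 Hz ltac:(lra) ltac:(lra) ltac:(lra)).
destruct (one 1 ltac:(lra)) as [E1|E1], (one (-1) ltac:(lra)) as [E2|E2]; lra.
Qed.

Lemma continuous_eps (f : R -> R) (x : R) (eps : posreal) : continuous f x ->
  exists d : posreal, forall y, Rabs (y - x) < d -> Rabs (f y - f x) < eps.
Proof.
intros H; destruct (proj1 (filterlim_locally _ _) H eps) as [d Hd].
exists d; intros y Hy; exact (Hd y Hy).
Qed.

Definition orb_dA (z th : R) : R :=
  orb_s z * orb_n z * sin th / (1 + orb_n z * cos th) ^ 2.

Lemma is_derive_orb_A_cos (z th : R) : 0 < z < / 3 ->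
  is_derive (fun t => orb_A z (cos t)) th (orb_dA z th).
Proof.
intros Hz; assert (D := orb_den z _ Hz (cos2_le_1 th)).
replace (orb_dA z th) with
  (- sin th * (- orb_s z * orb_n z / (1 + orb_n z * cos th) ^ 2))
  by (unfold orb_dA; field; lra).
apply (is_derive_comp (orb_A z) cos); [apply orb_A_deriv, cos2_le_1; exact Hz|].
auto_derive; [exact I | ring].
Qed.

Lemma orb_dA_continuous (z th : R) : 0 < z < / 3 -> continuous (orb_dA z) th.
Proof.
intros Hz; assert (D := orb_den z _ Hz (cos2_le_1 th)).
apply (ex_derive_continuous (orb_dA z)); unfold orb_dA; auto_derive.
apply Rgt_not_eq; simpl; nra.
Qed.

Lemma sqrt_U_orb (z th : R) : 0 < z < / 3 -> 0 < th < PI ->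
  0 < orb_dA z th /\
  - 2 * U_K (orb_K z) (orb_A z (cos th)) = (orb_dA z th * speed z th) ^ 2.
Proof.
intros Hz Ht.
assert (D := orb_den z _ Hz (cos2_le_1 th)).
destruct (orb_s_spec z Hz) as [Hs _], (orb_n_spec z Hz) as [Hn _].
assert (S := sin_gt_0 th (proj1 Ht) (proj2 Ht)).
split.
{ apply Rdiv_lt_0_compat; [|apply pow_lt, D]; repeat apply Rmult_lt_0_compat; lra. }
assert (En := orb_energy z (cos th) (speed z th * sin th) Hz (cos2_le_1 th)).
replace ((orb_dA z th * speed z th) ^ 2)
  with (orb_E z (cos th) (speed z th * sin th) ^ 2 / 4)
  by (unfold orb_dA, orb_E; field; lra).
rewrite En; [unfold U_K; field|].
rewrite Rpow_mult_distr, speed_sqr by exact Hz.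
assert (SC := sin2_cos2 th); unfold Rsqr in SC.
replace (sin th ^ 2) with (1 - cos th ^ 2) by lra; ring.
Qed.

(** The substitution [y = orb_A z (cos t)] turns [dy / sqrt (- 2 U)] into [dt / speed]. It is made
    away from the ends, where the integrand is singular. *)
Lemma RInt_U_orb (z t1 t2 v : R) : 0 < z < / 3 -> 0 < t1 -> t1 < t2 -> t2 < PI ->
  is_RInt (fun y => / sqrt (- 2 * U_K (orb_K z) y))
    (orb_A z (cos t1)) (orb_A z (cos t2)) v ->
  v = RInt (fun t => / speed z t) 0 t2 - RInt (fun t => / speed z t) 0 t1.
Proof.
intros Hz H1 H12 H2 Hv.
set (f := fun y => / sqrt (- 2 * U_K (orb_K z) y)) in *.
assert (I : is_RInt (fun t => scal (orb_dA z t) (f (orb_A z (cos t)))) t1 t2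
              (RInt f (orb_A z (cos t1)) (orb_A z (cos t2)))).
{ apply (is_RInt_comp f (fun t => orb_A z (cos t)) (orb_dA z));
    rewrite Rmin_left, Rmax_right by lra; intros t Ht.
  - destruct (sqrt_U_orb z t Hz ltac:(lra)) as [P Q].
    destruct (speed_pos z t Hz) as [_ P'].
    assert (PP : 0 < (orb_dA z t * speed z t) ^ 2)
      by (apply pow_lt, Rmult_lt_0_compat; assumption).
    rewrite <- Q in PP.
    apply (ex_derive_continuous f); unfold f, U_K in *; auto_derive.
    split; [lra|]; split; [|exact I].
    apply Rgt_not_eq, sqrt_lt_R0; lra.
  - split; [now apply is_derive_orb_A_cos | now apply orb_dA_continuous]. }
apply (is_RInt_unique (V := R_CompleteNormedModule)) in Hv; rewrite Hv in I.
assert (J : is_RInt (fun t => / speed z t) t1 t2 v).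
{ revert I; apply is_RInt_ext; rewrite Rmin_left, Rmax_right by lra; intros t Ht.
  destruct (sqrt_U_orb z t Hz ltac:(lra)) as [P Q].
  destruct (speed_pos z t Hz) as [_ P'].
  unfold f; rewrite Q, sqrt_pow2 by (apply Rmult_le_pos; lra).
  unfold scal; simpl; unfold mult; simpl; field; lra. }
apply (is_RInt_unique (V := R_CompleteNormedModule)) in J; rewrite <- J.
assert (Ch := RInt_Chasles (V := R_CompleteNormedModule) (fun t => / speed z t) 0 t1 t2
  (ex_RInt_inv_speed z _ _ Hz) (ex_RInt_inv_speed z _ _ Hz)).
unfold plus in Ch; simpl in Ch; lra.
Qed.

Lemma is_tau_period (K t : R) : is_tau K t ->
  exists z, 0 < z < / 3 /\ K = orb_K z /\ t = 2 * half_period z.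
Proof.
intros [a [b [c [Ha [ab [Hb [Hc [Ea [Eb [Ec [_ HI]]]]]]]]]]].
destruct (U_K_roots_param K a b c Ha ab Hb Hc Ea Eb Ec) as [z [Hz [EK [Aa Ab]]]].
exists z; split; [exact Hz|]; split; [exact EK|].
set (P := RInt (fun t => / speed z t) 0).
assert (P0 : P 0 = 0) by apply (@RInt_point R_CompleteNormedModule).
cut (t / 2 = half_period z); [lra|].
assert (Pc : forall x, continuous P x).
{ intros x; apply (ex_derive_continuous P); eexists; now apply is_derive_phase_time. }
assert (yc : forall x, continuous (fun th => orb_A z (cos th)) x).
{ intros x; apply (ex_derive_continuous (fun th => orb_A z (cos th))).
  eexists; now apply is_derive_orb_A_cos. }
assert (pi0 := PI_RGT_0).
apply Rminus_diag_uniq, cond_eq.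
intros e e0; rewrite Rminus_0_r.
(* One third for the convergence of the improper integral, one for the phase cut off at each end. *)
assert (e3 : 0 < e / 3) by lra.
set (eps := mkposreal _ e3).
destruct (HI (ball (t / 2) eps) (locally_ball _ _)) as [Q1 Q2 [d1 H1] [d2 H2] HQ].
destruct (continuous_eps _ 0 d1 (yc 0)) as [d3 H3].
destruct (continuous_eps _ 0 eps (Pc 0)) as [d4 H4].
destruct (continuous_eps _ PI d2 (yc PI)) as [d5 H5].
destruct (continuous_eps _ PI eps (Pc PI)) as [d6 H6].
set (k := Rmin (PI / 3) (Rmin (Rmin (d3 / 2) (d4 / 2)) (Rmin (d5 / 2) (d6 / 2)))).
assert (k1 : k <= PI / 3) by apply Rmin_l.
assert (k2 : k <= Rmin (Rmin (d3 / 2) (d4 / 2)) (Rmin (d5 / 2) (d6 / 2))) by apply Rmin_r.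
assert (k3 := Rle_trans _ _ _ k2 (Rmin_l _ _)).
assert (k4 := Rle_trans _ _ _ k2 (Rmin_r _ _)).
assert (k5 := Rle_trans _ _ _ k3 (Rmin_l _ _)).
assert (k6 := Rle_trans _ _ _ k3 (Rmin_r _ _)).
assert (k7 := Rle_trans _ _ _ k4 (Rmin_l _ _)).
assert (k8 := Rle_trans _ _ _ k4 (Rmin_r _ _)).
assert (k0 : 0 < k).
{ destruct d3, d4, d5, d6; simpl in *.
  repeat apply Rmin_pos; lra. }
specialize (H3 k); specialize (H4 k); specialize (H5 (PI - k)); specialize (H6 (PI - k)).
rewrite Rminus_0_r, Rabs_pos_eq in H3, H4 by lra.
replace (PI - k - PI) with (- k) in H5, H6 by ring.
rewrite Rabs_Ropp, Rabs_pos_eq in H5, H6 by lra.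
specialize (H3 ltac:(destruct d3; simpl in *; lra)).
specialize (H4 ltac:(destruct d4; simpl in *; lra)).
specialize (H5 ltac:(destruct d5; simpl in *; lra)).
specialize (H6 ltac:(destruct d6; simpl in *; lra)).
rewrite cos_0 in H3; rewrite cos_PI in H5; rewrite <- Aa in H3; rewrite <- Ab in H5.
assert (c1 : cos k < 1).
{ rewrite <- cos_0; apply cos_decreasing_1; lra. }
assert (c2 : -1 < cos (PI - k)).
{ rewrite <- cos_PI; apply cos_decreasing_1; lra. }
assert (q1 : Q1 (orb_A z (cos k))).
{ apply H1; [exact H3|]; rewrite Aa; apply orb_A_decr; try assumption; try lra.
  apply cos2_le_1. }
assert (q2 : Q2 (orb_A z (cos (PI - k)))).
{ apply H2; [exact H5|]; rewrite Ab; apply orb_A_decr; try assumption; try lra.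
  apply cos2_le_1. }
destruct (HQ _ _ q1 q2) as [v [Hv Bv]]; simpl in Hv.
rewrite EK in Hv.
apply RInt_U_orb in Hv; try lra; fold P in Hv.
assert (Bv' : Rabs (v - t / 2) < e / 3) by exact Bv.
simpl in H4, H6; rewrite P0 in H4.
change (half_period z) with (P PI).
apply Rabs_def2 in Bv'; apply Rabs_def2 in H4; apply Rabs_def2 in H6.
apply Rabs_def1; lra.
Qed.

(** * Uniqueness for the initial value problem *)

(** [E x * exp (- c x)] does not increase and [E x * exp (c x)] does not decrease; the first serves
    to the right of [x0], the second to the left. *)
Lemma gronwall_01 (E E' : R -> R) (c x0 : R) :
  (forall x, 0 <= x <= 1 -> continuity_pt E x) ->
  (forall x, 0 < x < 1 -> is_derive E x (E' x)) ->
  (forall x, 0 < x < 1 -> Rabs (E' x) <= c * E x) ->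
  (forall x, 0 <= x <= 1 -> 0 <= E x) ->
  0 <= x0 <= 1 -> E x0 = 0 -> forall x, 0 <= x <= 1 -> E x = 0.
Proof.
intros Ec dE HE E0 Hx0 Ex0 x Hx.
assert (key : forall k a b, k = c \/ k = - c -> 0 <= a -> a <= b -> b <= 1 -> exists w,
  E b * exp (k * b) - E a * exp (k * a) = w * (b - a) /\
  (k = c -> 0 <= w) /\ (k = - c -> w <= 0)).
{ intros k a b Hk Ha ab Hb.
  destruct (Req_dec a b) as [<-|ne].
  { exists 0; split; [ring | split; lra]. }
  (* The mean value point may be 0 or 1, where no derivative is known. The default value 0 there
     satisfies both sign conditions. *)
  destruct (MVT_gen (fun t => E t * exp (k * t)) a b
    (fun t => if Rlt_dec 0 t then if Rlt_dec t 1 then (E' t + k * E t) * exp (k * t) else 0 else 0))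
    as [t [Ht Et]].
  - rewrite Rmin_left, Rmax_right by lra; intros t Ht.
    destruct (Rlt_dec 0 t), (Rlt_dec t 1); try lra.
    assert (D := dE t ltac:(lra)).
    assert (eE : Derive (fun t : R => E t) t = _) by exact (is_derive_unique _ _ _ D).
    auto_derive; [eexists; exact D|].
    rewrite eE; ring.
  - rewrite Rmin_left, Rmax_right by lra; intros t Ht.
    apply (continuity_pt_mult E (fun t => exp (k * t))); [apply Ec; lra|].
    apply continuity_pt_filterlim, (ex_derive_continuous (fun t => exp (k * t))).
    auto_derive; exact I.
  - eexists; split; [exact Et|].
    destruct (Rlt_dec 0 t); [|lra].
    destruct (Rlt_dec t 1); [|lra].
    assert (X := exp_pos (k * t)).
    assert (B := HE t ltac:(lra)); apply Rabs_le_between in B.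
    split; intros ->; nra. }
assert (0 <= E x) by now apply E0.
cut (E x <= 0); [lra|].
destruct (Rle_lt_dec x0 x) as [L|L].
- destruct (key (- c) x0 x (or_intror eq_refl)) as [w [Ew [_ Hw]]]; try lra.
  specialize (Hw eq_refl); rewrite Ex0 in Ew.
  assert (X := exp_pos (- c * x)); nra.
- destruct (key c x x0 (or_introl eq_refl)) as [w [Ew [Hw _]]]; try lra.
  specialize (Hw eq_refl); rewrite Ex0 in Ew.
  assert (X := exp_pos (c * x)); nra.
Qed.

(** Common ground for global solutions and for given solutions extended by constants, which need not
    have two-sided derivatives at 0 and 1. *)
Definition LV01 (beta : R) (A B C : R -> R) : Prop :=
  (forall x, 0 <= x <= 1 -> continuity_pt A x /\ continuity_pt B x /\ continuity_pt C x) /\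
  (forall x, 0 < x < 1 -> 0 < A x < 1 /\ 0 < B x < 1 /\ 0 < C x < 1 /\
    is_derive A x (beta * A x * (C x - B x)) /\
    is_derive B x (beta * B x * (A x - C x)) /\
    is_derive C x (beta * C x * (B x - A x))).

Lemma LV01_unique (beta x0 : R) (A B C A' B' C' : R -> R) : 0 < beta ->
  LV01 beta A B C -> LV01 beta A' B' C' -> 0 <= x0 <= 1 ->
  A x0 = A' x0 -> B x0 = B' x0 -> C x0 = C' x0 ->
  forall x, 0 <= x <= 1 -> A x = A' x /\ B x = B' x /\ C x = C' x.
Proof.
intros Hb [c d] [c' d'] Hx0 EA EB EC.
set (E := fun x => (A x - A' x) * (A x - A' x) + (B x - B' x) * (B x - B' x)
                   + (C x - C' x) * (C x - C' x)).
assert (Z : forall x, 0 <= x <= 1 -> E x = 0).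
{ apply (gronwall_01 E (fun x => 2 * (
      (A x - A' x) * (beta * A x * (C x - B x) - beta * A' x * (C' x - B' x))
    + (B x - B' x) * (beta * B x * (A x - C x) - beta * B' x * (A' x - C' x))
    + (C x - C' x) * (beta * C x * (B x - A x) - beta * C' x * (B' x - A' x)))) (6 * beta) x0);
    try assumption.
  - intros x Hx; destruct (c x Hx) as [? [? ?]], (c' x Hx) as [? [? ?]].
    assert (sq : forall f f', continuity_pt f x -> continuity_pt f' x ->
      continuity_pt (mult_fct (minus_fct f f') (minus_fct f f')) x).
    { intros f f' cf cf'; apply continuity_pt_mult; now apply continuity_pt_minus. }
    exact (continuity_pt_plus _ _ x
      (continuity_pt_plus _ _ x (sq A A' ltac:(assumption) ltac:(assumption))
        (sq B B' ltac:(assumption) ltac:(assumption)))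
      (sq C C' ltac:(assumption) ltac:(assumption))).
  - intros x Hx.
    destruct (d x Hx) as [_ [_ [_ [dA [dB dC]]]]], (d' x Hx) as [_ [_ [_ [dA' [dB' dC']]]]].
    assert (eA : Derive (fun t : R => A t) x = _) by exact (is_derive_unique _ _ _ dA).
    assert (eB : Derive (fun t : R => B t) x = _) by exact (is_derive_unique _ _ _ dB).
    assert (eC : Derive (fun t : R => C t) x = _) by exact (is_derive_unique _ _ _ dC).
    assert (eA' : Derive (fun t : R => A' t) x = _) by exact (is_derive_unique _ _ _ dA').
    assert (eB' : Derive (fun t : R => B' t) x = _) by exact (is_derive_unique _ _ _ dB').
    assert (eC' : Derive (fun t : R => C' t) x = _) by exact (is_derive_unique _ _ _ dC').
    unfold E; auto_derive.
    + repeat split; eexists; eassumption.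
    + rewrite eA, eB, eC, eA', eB', eC'; ring.
  - intros x Hx.
    destruct (d x Hx) as [rA [rB [rC _]]], (d' x Hx) as [rA' [rB' [rC' _]]].
    unfold E.
    set (a := A x - A' x); set (b := B x - B' x); set (k := C x - C' x).
    replace (2 * _) with (2 * beta * (a * a * (C x - B x) + b * b * (A x - C x) + k * k * (B x - A x)
      + A' x * (a * k - a * b) + B' x * (b * a - b * k) + C' x * (k * b - k * a)))
      by (unfold a, b, k; ring).
    rewrite Rabs_mult, (Rabs_pos_eq (2 * beta)) by lra.
    (* For each square, the diagonal terms contribute at most 1 to its coefficient and the six cross
       terms at most 2. *)
    replace (6 * beta * (a * a + b * b + k * k)) with (2 * beta * (3 * (a * a + b * b + k * k))) by ring.
    apply Rmult_le_compat_l; [lra|].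
    assert (sq : forall u v w, 0 < u < 1 -> 0 < v < 1 -> - (w * w) <= w * w * (u - v) <= w * w).
    { intros u v w Hu Hv; assert (Q : 0 <= w * w) by apply Rle_0_sqr.
      assert (0 <= w * w * (1 - (u - v))) by (apply Rmult_le_pos; lra).
      assert (0 <= w * w * (1 + (u - v))) by (apply Rmult_le_pos; lra).
      lra. }
    assert (cr : forall u v w, 0 < u < 1 ->
      - ((v * v + w * w) / 2) <= u * (v * w) <= (v * v + w * w) / 2).
    { intros u v w Hu.
      assert (0 <= (v - w) * (v - w)) by apply Rle_0_sqr.
      assert (0 <= (v + w) * (v + w)) by apply Rle_0_sqr.
      assert (- ((v * v + w * w) / 2) <= v * w <= (v * v + w * w) / 2) by lra.
      assert (0 <= u * ((v * v + w * w) / 2 - v * w)) by (apply Rmult_le_pos; lra).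
      assert (0 <= u * ((v * v + w * w) / 2 + v * w)) by (apply Rmult_le_pos; lra).
      assert (0 <= (1 - u) * ((v * v + w * w) / 2)) by (apply Rmult_le_pos; lra).
      lra. }
    assert (S1 := sq (C x) (B x) a rC rB); assert (S2 := sq (A x) (C x) b rA rC).
    assert (S3 := sq (B x) (A x) k rB rA).
    assert (T1 := cr (A' x) a k rA'); assert (T2 := cr (A' x) a b rA').
    assert (T3 := cr (B' x) b a rB'); assert (T4 := cr (B' x) b k rB').
    assert (T5 := cr (C' x) k b rC'); assert (T6 := cr (C' x) k a rC').
    apply Rabs_le; lra.
  - intros x _; unfold E; repeat apply Rplus_le_le_0_compat; apply Rle_0_sqr.
  - unfold E; rewrite EA, EB, EC; ring. }
intros x Hx; specialize (Z x Hx); unfold E in Z.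
assert (sq : forall w, 0 <= w * w) by exact Rle_0_sqr.
assert (s1 := sq (A x - A' x)); assert (s2 := sq (B x - B' x)); assert (s3 := sq (C x - C' x)).
assert (z : forall w, w * w = 0 -> w = 0) by (intros w H; apply Rmult_integral in H; lra).
assert (z1 := z (A x - A' x) ltac:(lra)); assert (z2 := z (B x - B' x) ltac:(lra)).
assert (z3 := z (C x - C' x) ltac:(lra)).
repeat split; lra.
Qed.

Lemma LV_continuity_pt (beta : R) (A B C : R -> R) (x : R) : LV beta A B C ->
  continuity_pt A x /\ continuity_pt B x /\ continuity_pt C x.
Proof.
intros H; destruct (H x) as [_ [_ [_ [_ [? [? ?]]]]]].
split; [|split]; apply continuity_pt_filterlim;
  [apply (ex_derive_continuous A) | apply (ex_derive_continuous B)
  | apply (ex_derive_continuous C)]; eexists; eassumption.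
Qed.

Lemma LV_LV01 (beta : R) (A B C : R -> R) : LV beta A B C -> LV01 beta A B C.
Proof.
intros H; split.
- intros x _; now apply (LV_continuity_pt beta).
- intros x _; destruct (H x) as [? [? [? [? [? [? ?]]]]]].
  do 3 (split; [lra|]); split; [|split]; assumption.
Qed.

(** Composition with it turns continuity relative to [[0, 1]] into continuity on the line. *)
Definition clamp01 (x : R) : R := Rmax 0 (Rmin 1 x).

Lemma clamp01_id (x : R) : 0 <= x <= 1 -> clamp01 x = x.
Proof. intros H; unfold clamp01; rewrite Rmin_right, Rmax_right; lra. Qed.

Lemma clamp01_range (x : R) : 0 <= clamp01 x <= 1.
Proof.
unfold clamp01; split; [apply Rmax_l|].
apply Rmax_lub; [lra | apply Rmin_l].
Qed.

Lemma clamp01_lip (x y : R) : 0 <= x <= 1 -> Rabs (clamp01 y - x) <= Rabs (y - x).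
Proof.
intros H; unfold clamp01, Rmax, Rmin.
destruct (Rle_dec 1 y); destruct (Rle_dec 0 _); unfold Rabs;
  repeat destruct Rcase_abs; lra.
Qed.

Lemma is_derive_01_eps (f : R -> R) (x d : R) (eps : posreal) : is_derive_01 f x d ->
  exists delta : posreal, forall h, Rabs h < delta -> h <> 0 -> 0 <= x + h <= 1 ->
    Rabs ((f (x + h) - f x) / h - d) < eps.
Proof.
intros H; destruct (H (ball d eps) (locally_ball d eps)) as [delta Hd].
exists delta; intros h h1 h2 h3; apply (Hd h); [|now split].
change (Rabs (h - 0) < delta); now rewrite Rminus_0_r.
Qed.

Lemma is_derive_01_continuity (f : R -> R) (x d : R) : 0 <= x <= 1 ->
  is_derive_01 f x d -> continuity_pt (fun t => f (clamp01 t)) x.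
Proof.
intros Hx H eps e0.
destruct (is_derive_01_eps f x d (mkposreal 1 Rlt_0_1) H) as [delta Hd]; simpl in Hd.
set (c := Rabs d + 1).
assert (c0 : 0 < c) by (unfold c; assert (P := Rabs_pos d); lra).
exists (Rmin delta (eps / c)); split.
{ apply Rmin_pos; [apply cond_pos | apply Rdiv_lt_0_compat; lra]. }
intros y [_ Hy]; simpl in *; unfold R_dist in *.
rewrite (clamp01_id x Hx).
assert (L := clamp01_lip x y Hx); assert (Rg := clamp01_range y).
set (h := clamp01 y - x) in *.
replace (clamp01 y) with (x + h) in * by (unfold h; ring).
assert (m1 := Rmin_l delta (eps / c)); assert (m2 := Rmin_r delta (eps / c)).
destruct (Req_dec h 0) as [->|hn].
{ rewrite Rplus_0_r, Rminus_diag, Rabs_R0; exact e0. }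
specialize (Hd h ltac:(lra) hn Rg).
assert (q : Rabs ((f (x + h) - f x) / h) <= c).
{ replace ((f (x + h) - f x) / h) with (((f (x + h) - f x) / h - d) + d) by ring.
  eapply Rle_trans; [apply Rabs_triang | unfold c; lra]. }
replace (f (x + h) - f x) with ((f (x + h) - f x) / h * h) by (field; exact hn).
rewrite Rabs_mult.
apply Rle_lt_trans with (c * Rabs h).
{ apply Rmult_le_compat_r; [apply Rabs_pos | exact q]. }
replace eps with (c * (eps / c)) by (field; lra).
apply Rmult_lt_compat_l; lra.
Qed.

Lemma is_derive_01_interior (f : R -> R) (x d : R) : 0 < x < 1 ->
  is_derive_01 f x d -> is_derive (fun t => f (clamp01 t)) x d.
Proof.
intros Hx H; apply is_derive_Reals; intros eps e0.
destruct (is_derive_01_eps f x d (mkposreal eps e0) H) as [delta Hd]; simpl in Hd.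
assert (m0 : 0 < Rmin delta (Rmin x (1 - x))).
{ repeat apply Rmin_pos; [apply cond_pos | lra | lra]. }
exists (mkposreal _ m0); simpl; intros h hn hl.
assert (m1 := Rmin_l delta (Rmin x (1 - x))); assert (m2 := Rmin_r delta (Rmin x (1 - x))).
assert (m3 := Rmin_l x (1 - x)); assert (m4 := Rmin_r x (1 - x)).
assert (Hh : - x < h < 1 - x) by (apply Rabs_def2 in hl; lra).
rewrite !clamp01_id by lra.
apply Hd; [lra | exact hn | lra].
Qed.

Lemma ELE_LV01 (beta rA rB rC : R) (A B C : R -> R) :
  ELE_solution beta rA rB rC A B C ->
  LV01 beta (fun t => A (clamp01 t)) (fun t => B (clamp01 t)) (fun t => C (clamp01 t)).
Proof.
intros [H _]; split.
- intros x Hx; destruct (H x Hx) as [_ [_ [_ [_ [dA [dB dC]]]]]].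
  split; [|split]; eapply is_derive_01_continuity; eassumption.
- intros x Hx; destruct (H x ltac:(lra)) as [? [? [? [_ [dA [dB dC]]]]]].
  rewrite !clamp01_id by lra.
  do 3 (split; [assumption|]).
  split; [|split]; apply is_derive_01_interior; assumption.
Qed.

(** * Chords of orbits *)

(** This is [1 + w <= exp w] at [w = ln (b / a)], multiplied by [a]. *)
Lemma relative_entropy_term (a b : R) : 0 < a -> 0 < b ->
  a - b <= a * (ln a - ln b) /\ (a <> b -> a - b < a * (ln a - ln b)).
Proof.
intros Ha Hb.
set (w := ln b - ln a).
assert (E : a * exp w = b).
{ unfold w, Rminus; rewrite exp_plus, exp_Ropp, !exp_ln by assumption; field; lra. }
replace (ln a - ln b) with (- w) by (unfold w; ring).
split.
- assert (H := exp_ineq1_le w); nra.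
- intros ne; assert (H : 1 + w < exp w); [|nra].
  apply exp_ineq1; intros Z; apply ne; rewrite Z, exp_0 in E; lra.
Qed.

Lemma relative_entropy_pos (a b c a' b' c' : R) :
  0 < a -> 0 < b -> 0 < c -> 0 < a' -> 0 < b' -> 0 < c' ->
  a + b + c = 1 -> a' + b' + c' = 1 -> ~ (a = a' /\ b = b' /\ c = c') ->
  0 < a * (ln a - ln a') + b * (ln b - ln b') + c * (ln c - ln c').
Proof.
intros Ha Hb Hc Ha' Hb' Hc' S S' ne.
destruct (relative_entropy_term a a' Ha Ha') as [wA sA].
destruct (relative_entropy_term b b' Hb Hb') as [wB sB].
destruct (relative_entropy_term c c' Hc Hc') as [wC sC].
destruct (Req_dec a a') as [EA|NA]; [|specialize (sA NA); lra].
destruct (Req_dec b b') as [EB|NB]; [|specialize (sB NB); lra].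
exfalso; apply ne; repeat split; lra.
Qed.

(** Three times the inner product of [v] with the displacement of [(a, b, c)] from the centre
    [(1/3, 1/3, 1/3)]. *)
Definition chord_L (vA vB vC a b c : R) : R :=
  3 * (vA * a + vB * b + vC * c) - (vA + vB + vC).

(** Positive relative entropy gives [0 < lam <v, p> + mu], while the order of the products gives
    [lam (vA + vB + vC) + 3 mu <= 0]; eliminating [mu] is the first claim. Adding the two relative
    entropies is the second. *)
Lemma chord_sign (vA vB vC lam mu a b c a' b' c' : R) :
  0 < a -> 0 < b -> 0 < c -> 0 < a' -> 0 < b' -> 0 < c' ->
  a + b + c = 1 -> a' + b' + c' = 1 -> ~ (a = a' /\ b = b' /\ c = c') ->
  a * b * c <= a' * b' * c' ->
  ln a - ln a' = lam * vA + mu -> ln b - ln b' = lam * vB + mu ->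
  ln c - ln c' = lam * vC + mu ->
  0 < lam * chord_L vA vB vC a b c /\
  0 < lam * (chord_L vA vB vC a b c - chord_L vA vB vC a' b' c').
Proof.
intros Ha Hb Hc Ha' Hb' Hc' S S' ne HK EA EB EC.
assert (P := relative_entropy_pos a b c a' b' c' Ha Hb Hc Ha' Hb' Hc' S S' ne).
assert (P' := relative_entropy_pos a' b' c' a b c Ha' Hb' Hc' Ha Hb Hc S' S
  ltac:(intros [? [? ?]]; apply ne; repeat split; congruence)).
assert (Ls : (ln a - ln a') + (ln b - ln b') + (ln c - ln c') <= 0).
{ assert (ln (a * b * c) <= ln (a' * b' * c')).
  { apply ln_le; [|exact HK]; repeat apply Rmult_lt_0_compat; assumption. }
  rewrite !ln_mult in H by (repeat apply Rmult_lt_0_compat; assumption); lra. }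
replace (ln a' - ln a) with (- (lam * vA + mu)) in P' by lra.
replace (ln b' - ln b) with (- (lam * vB + mu)) in P' by lra.
replace (ln c' - ln c) with (- (lam * vC + mu)) in P' by lra.
rewrite EA, EB, EC in P, Ls.
unfold chord_L.
replace c with (1 - a - b) in * by lra; replace c' with (1 - a' - b') in * by lra.
split; nra.
Qed.

(** The equation says that the determinant of [v], [u] and [(1, 1, 1)] vanishes. *)
Lemma parallel (vA vB vC uA uB uC : R) : ~ (vA = vB /\ vB = vC) ->
  (vC - vB) * uA + (vA - vC) * uB + (vB - vA) * uC = 0 ->
  exists lam mu, uA = lam * vA + mu /\ uB = lam * vB + mu /\ uC = lam * vC + mu.
Proof.
intros ne E.
destruct (Req_dec vA vB) as [EAB|N].
- assert (N : vB - vC <> 0) by (intros Z; apply ne; lra).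
  exists ((uB - uC) / (vB - vC)), (uC - (uB - uC) / (vB - vC) * vC).
  assert (uA = uB).
  { subst vB; assert (P : (vA - vC) * (uB - uA) = 0) by lra.
    apply Rmult_integral in P; lra. }
  subst vB uA; repeat split; field; assumption.
- assert (N' : vA - vB <> 0) by lra.
  exists ((uA - uB) / (vA - vB)), (uB - (uA - uB) / (vA - vB) * vB).
  repeat split; try (field; assumption).
  apply (Rmult_eq_reg_l (vA - vB)); [|exact N'].
  field_simplify; [lra | assumption].
Qed.

(** The product along the ray is the cubic [1/27 - t^2 S / 6 + t^3 E], which decreases as long as
    [9 t E < S]; this is checked at the far end [s']. *)
Lemma ray_decr (e1 e2 e3 s s' : R) : e1 + e2 + e3 = 0 -> 0 < s < s' ->
  0 < / 3 + s' * e1 -> 0 < / 3 + s' * e2 -> 0 < / 3 + s' * e3 ->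
  ~ (e1 = 0 /\ e2 = 0) ->
  (/ 3 + s' * e1) * (/ 3 + s' * e2) * (/ 3 + s' * e3) <
  (/ 3 + s * e1) * (/ 3 + s * e2) * (/ 3 + s * e3).
Proof.
intros Z Hs P1 P2 P3 ne.
set (S := e1 * e1 + e2 * e2 + e3 * e3); set (E := e1 * e2 * e3).
assert (S0 : 0 < S).
{ unfold S; destruct (Req_dec e1 0) as [->|]; [|nra].
  destruct (Req_dec e2 0) as [->|]; [|nra]. exfalso; apply ne; lra. }
assert (f : forall t, (/ 3 + t * e1) * (/ 3 + t * e2) * (/ 3 + t * e3)
  = / 27 - t ^ 2 * S / 6 + t ^ 3 * E).
{ intros t; unfold S, E; replace e3 with (- e1 - e2) by lra; field. }
(* [P1 P2 + P2 P3 + P3 P1 >= 9 P1 P2 P3] on the simplex *)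
assert (G : 9 * s' * E < S).
{ assert (I : s' ^ 2 * (S - 9 * s' * E) =
    s' ^ 2 * ((/ 3 + s' * e1) * ((e2 - e3) * (e2 - e3)) + (/ 3 + s' * e2) * ((e1 - e3) * (e1 - e3))
      + (/ 3 + s' * e3) * ((e1 - e2) * (e1 - e2)))).
  { unfold S, E; replace e3 with (- e1 - e2) by lra; field. }
  apply Rmult_eq_reg_l in I; [|apply Rgt_not_eq, pow_lt; lra].
  assert (q : forall w, 0 <= w * w) by (intros; nra).
  assert (r : forall u w, 0 < u -> 0 <= u * (w * w)).
  { intros u w Hu; apply Rmult_le_pos; [lra | apply q]. }
  assert (r1 := r _ (e2 - e3) P1); assert (r2 := r _ (e1 - e3) P2).
  assert (r3 := r _ (e1 - e2) P3).
  destruct (Req_dec e1 e2) as [E12|N12].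
  - assert (N : e1 - e3 <> 0) by (intros N; apply ne; lra).
    assert (0 < (e1 - e3) * (e1 - e3)) by nra.
    assert (0 < (/ 3 + s' * e2) * ((e1 - e3) * (e1 - e3))) by now apply Rmult_lt_0_compat.
    lra.
  - assert (N : e1 - e2 <> 0) by lra.
    assert (0 < (e1 - e2) * (e1 - e2)) by nra.
    assert (0 < (/ 3 + s' * e3) * ((e1 - e2) * (e1 - e2))) by now apply Rmult_lt_0_compat.
    lra. }
rewrite !f; clearbody S E.
assert (T : 0 < (s' - s) * ((s + s') * S / 6 - (s ^ 2 + s * s' + s' ^ 2) * E)).
{ apply Rmult_lt_0_compat; [lra|].
  destruct (Rle_lt_dec E 0) as [E0|E0].
  - assert (0 < (s + s') * S) by nra.
    assert (0 < s ^ 2 + s * s' + s' ^ 2) by nra.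
    nra.
  - assert ((s + s') * (9 * s' * E) < (s + s') * S) by (apply Rmult_lt_compat_l; lra).
    assert (0 <= (s' - s) * (s' + 2 * s) * E).
    { repeat apply Rmult_le_pos; lra. }
    nra. }
nra.
Qed.

Lemma line_through_centre (vA vB vC a b c : R) : ~ (vA = vB /\ vB = vC) ->
  a + b + c = 1 -> chord_L vA vB vC a b c = 0 ->
  exists s, a = / 3 + s * (vB - vC) /\ b = / 3 + s * (vC - vA) /\ c = / 3 + s * (vA - vB).
Proof.
unfold chord_L; intros ne S L.
destruct (Req_dec vA vB) as [E|N].
- assert (N : vB - vC <> 0) by (intros Z; apply ne; lra).
  exists ((a - / 3) / (vB - vC)).
  assert (c = / 3).
  { assert (P : (vB - vC) * (c - / 3) = 0) by (rewrite E in L; replace a with (1 - b - c) in L by lra; lra).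
    apply Rmult_integral in P; lra. }
  subst vA; replace ((a - / 3) / (vB - vC) * (vC - vB)) with (/ 3 - a) by (field; lra).
  rewrite Rminus_diag; repeat split; [field; lra | lra | lra].
- assert (N' : vA - vB <> 0) by lra.
  exists ((c - / 3) / (vA - vB)).
  assert (M : forall x y, (vA - vB) * (x - / 3) = (c - / 3) * y ->
    x = / 3 + (c - / 3) / (vA - vB) * y).
  { intros x y H; replace ((c - / 3) / (vA - vB) * y) with (((c - / 3) * y) / (vA - vB))
      by (field; assumption).
    rewrite <- H; field; assumption. }
  repeat split; apply M; replace b with (1 - a - c) in * by lra; lra.
Qed.

Lemma same_side (e1 e2 e3 s s' K : R) : e1 + e2 + e3 = 0 -> 0 < s * s' ->
  0 < / 3 + s * e1 -> 0 < / 3 + s * e2 -> 0 < / 3 + s * e3 ->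
  0 < / 3 + s' * e1 -> 0 < / 3 + s' * e2 -> 0 < / 3 + s' * e3 ->
  ~ (e1 = 0 /\ e2 = 0) ->
  (/ 3 + s * e1) * (/ 3 + s * e2) * (/ 3 + s * e3) = K ->
  (/ 3 + s' * e1) * (/ 3 + s' * e2) * (/ 3 + s' * e3) = K -> s = s'.
Proof.
intros Z ss P1 P2 P3 Q1 Q2 Q3 ne E E'.
assert (neg : forall t e : R, t * e = - t * - e) by (intros; ring).
destruct (Rtotal_order s s') as [L|[L|L]]; [exfalso|exact L|exfalso];
  destruct (Rlt_le_dec 0 s) as [s0|s0].
- assert (H := ray_decr e1 e2 e3 s s' Z ltac:(lra) Q1 Q2 Q3 ne); lra.
- assert (s' < 0) by nra.
  rewrite (neg s), (neg s e2), (neg s e3) in *.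
  rewrite (neg s'), (neg s' e2), (neg s' e3) in *.
  assert (H1 := ray_decr (- e1) (- e2) (- e3) (- s') (- s) ltac:(lra) ltac:(lra) P1 P2 P3
    ltac:(intros [? ?]; apply ne; lra)); lra.
- assert (0 < s') by nra.
  assert (H1 := ray_decr e1 e2 e3 s' s Z ltac:(lra) P1 P2 P3 ne); lra.
- rewrite (neg s), (neg s e2), (neg s e3) in *.
  rewrite (neg s'), (neg s' e2), (neg s' e3) in *.
  assert (s < 0) by nra.
  assert (s' < 0) by nra.
  assert (H1 := ray_decr (- e1) (- e2) (- e3) (- s) (- s') ltac:(lra) ltac:(lra) Q1 Q2 Q3
    ltac:(intros [? ?]; apply ne; lra)); lra.
Qed.

(** As [K < 1/27], none of the three points is the centre, so two of them lie on the same ray from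
    it, and the product is injective on a ray. *)
Lemma line_meets_orbit_twice (vA vB vC K a1 b1 c1 a2 b2 c2 a3 b3 c3 : R) :
  ~ (vA = vB /\ vB = vC) -> K < / 27 ->
  0 < a1 -> 0 < b1 -> 0 < c1 -> a1 + b1 + c1 = 1 -> a1 * b1 * c1 = K ->
  0 < a2 -> 0 < b2 -> 0 < c2 -> a2 + b2 + c2 = 1 -> a2 * b2 * c2 = K ->
  0 < a3 -> 0 < b3 -> 0 < c3 -> a3 + b3 + c3 = 1 -> a3 * b3 * c3 = K ->
  chord_L vA vB vC a1 b1 c1 = 0 -> chord_L vA vB vC a2 b2 c2 = 0 ->
  chord_L vA vB vC a3 b3 c3 = 0 ->
  (a1 = a2 /\ b1 = b2 /\ c1 = c2) \/ (a1 = a3 /\ b1 = b3 /\ c1 = c3) \/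
  (a2 = a3 /\ b2 = b3 /\ c2 = c3).
Proof.
intros ne HK A1 B1 C1 S1 K1 A2 B2 C2 S2 K2 A3 B3 C3 S3 K3 L1 L2 L3.
destruct (line_through_centre _ _ _ _ _ _ ne S1 L1) as [s1 [-> [-> ->]]].
destruct (line_through_centre _ _ _ _ _ _ ne S2 L2) as [s2 [-> [-> ->]]].
destruct (line_through_centre _ _ _ _ _ _ ne S3 L3) as [s3 [-> [-> ->]]].
set (e1 := vB - vC) in *; set (e2 := vC - vA) in *; set (e3 := vA - vB) in *.
assert (Z : e1 + e2 + e3 = 0) by (unfold e1, e2, e3; ring).
assert (ne' : ~ (e1 = 0 /\ e2 = 0)) by (unfold e1, e2; intros [? ?]; apply ne; lra).
assert (nz : forall s, (/ 3 + s * e1) * (/ 3 + s * e2) * (/ 3 + s * e3) = K -> s <> 0).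
{ intros s E ->; rewrite !Rmult_0_l, !Rplus_0_r in E; lra. }
assert (n1 := nz s1 K1); assert (n2 := nz s2 K2); assert (n3 := nz s3 K3).
destruct (Rlt_le_dec 0 (s1 * s2)) as [P|N12].
{ left; assert (s1 = s2) by (eapply (same_side e1 e2 e3); eassumption).
  subst s2; auto. }
destruct (Rlt_le_dec 0 (s1 * s3)) as [P|N13].
{ right; left; assert (s1 = s3) by (eapply (same_side e1 e2 e3); eassumption).
  subst s3; auto. }
right; right; assert (s2 = s3); [|subst s3; auto].
eapply (same_side e1 e2 e3); try eassumption.
destruct (Rdichotomy _ _ n1), (Rdichotomy _ _ n2), (Rdichotomy _ _ n3); nra.
Qed.

(** * Uniqueness for given means *)

(** The determinant of [v], [ln p] and [(1, 1, 1)]. *)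
Definition chord_xi (vA vB vC : R) (A B C : R -> R) (x : R) : R :=
  (vC - vB) * ln (A x) + (vA - vC) * ln (B x) + (vB - vA) * ln (C x).

Lemma is_derive_ln_comp (f : R -> R) (x d : R) :
  0 < f x -> is_derive f x (d * f x) -> is_derive (fun t => ln (f t)) x d.
Proof.
intros P D; replace d with (d * f x * / f x) by (field; lra).
apply (is_derive_comp ln f); [now apply is_derive_ln | exact D].
Qed.

Lemma LV_is_derive_ln (beta : R) (A B C : R -> R) (x : R) : LV beta A B C ->
  is_derive (fun t => ln (A t)) x (beta * (C x - B x)) /\
  is_derive (fun t => ln (B t)) x (beta * (A x - C x)) /\
  is_derive (fun t => ln (C t)) x (beta * (B x - A x)).
Proof.
intros H; destruct (H x) as [PA [PB [PC [_ [dA [dB dC]]]]]].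
split; [|split]; apply is_derive_ln_comp; try assumption.
- now replace (beta * (C x - B x) * A x) with (beta * A x * (C x - B x)) by ring.
- now replace (beta * (A x - C x) * B x) with (beta * B x * (A x - C x)) by ring.
- now replace (beta * (B x - A x) * C x) with (beta * C x * (B x - A x)) by ring.
Qed.

Lemma is_derive_chord_xi (beta vA vB vC : R) (A B C : R -> R) (x : R) : LV beta A B C ->
  is_derive (chord_xi vA vB vC A B C) x (beta * chord_L vA vB vC (A x) (B x) (C x)).
Proof.
intros H; destruct (LV_is_derive_ln beta A B C x H) as [dA [dB dC]].
destruct (H x) as [_ [_ [_ [S _]]]].
replace (beta * chord_L vA vB vC (A x) (B x) (C x))
  with ((vC - vB) * (beta * (C x - B x)) + (vA - vC) * (beta * (A x - C x))
        + (vB - vA) * (beta * (B x - A x))).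
2:{ unfold chord_L; replace (C x) with (1 - A x - B x) by lra; ring. }
apply (is_derive_plus (fun t => (vC - vB) * ln (A t) + (vA - vC) * ln (B t))).
- apply (is_derive_plus (fun t => (vC - vB) * ln (A t))).
  + apply (is_derive_scal (fun t => ln (A t))), dA.
  + apply (is_derive_scal (fun t => ln (B t))), dB.
- apply (is_derive_scal (fun t => ln (C t))), dC.
Qed.

Lemma chord_L_zero (beta vA vB vC a b : R) (A B C : R -> R) : LV beta A B C -> a < b ->
  chord_L vA vB vC (A a) (B a) (C a) * chord_L vA vB vC (A b) (B b) (C b) <= 0 ->
  exists t, a <= t <= b /\ chord_L vA vB vC (A t) (B t) (C t) = 0.
Proof.
intros H ab Hs.
destruct (IVT_cor (fun t => chord_L vA vB vC (A t) (B t) (C t)) a b) as [t Ht];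
  [|lra|exact Hs|now exists t].
intros t; destruct (H t) as [_ [_ [_ [_ [dA [dB dC]]]]]].
apply continuity_pt_filterlim,
  (ex_derive_continuous (fun t => chord_L vA vB vC (A t) (B t) (C t))).
unfold chord_L; auto_derive; repeat split; eexists; eassumption.
Qed.

(** Rescaling time by [t] brings the meeting point to time 1, where uniqueness on [[0, 1]] applies
    backwards. *)
Lemma LV_unique_at_0 (beta t : R) (A B C A' B' C' : R -> R) : 0 < beta -> 0 <= t ->
  LV beta A B C -> LV beta A' B' C' ->
  A t = A' t -> B t = B' t -> C t = C' t -> A 0 = A' 0 /\ B 0 = B' 0 /\ C 0 = C' 0.
Proof.
intros Hb Ht H H' EA EB EC.
destruct (Req_dec t 0) as [->|tn]; [auto|].
assert (scale : forall f d x, is_derive f (t * x) d -> is_derive (fun y => f (t * y)) x (t * d)).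
{ intros f d x D; apply (is_derive_comp f (fun y => t * y)); [exact D|].
  auto_derive; [exact I | ring]. }
assert (LVs : forall f g h, LV beta f g h ->
  LV (t * beta) (fun y => f (t * y)) (fun y => g (t * y)) (fun y => h (t * y))).
{ intros f g h L x; destruct (L (t * x)) as [? [? [? [? [df [dg dh]]]]]].
  do 4 (split; [assumption|]).
  rewrite !Rmult_assoc; split; [|split]; apply scale; rewrite <- Rmult_assoc; assumption. }
assert (U := LV01_unique (t * beta) 1 _ _ _ _ _ _ ltac:(apply Rmult_lt_0_compat; lra)
  (LV_LV01 _ _ _ _ (LVs _ _ _ H)) (LV_LV01 _ _ _ _ (LVs _ _ _ H')) ltac:(lra)).
cbv beta in U; rewrite Rmult_1_r in U.
specialize (U EA EB EC 0 ltac:(lra)); now rewrite Rmult_0_r in U.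
Qed.

(* Equal log-ratios at times [0] and [1] force the vector [ln p - ln q], whose direction
   turns monotonically, to make a full turn within [[0, 1]], hence, before time [Tq],
   more than a full turn; [g] vanishes at the half turns. *)
Lemma no_full_turn (beta Kp Kq Tp Tq : R) (pA pB pC qA qB qC : R -> R) :
  0 < beta -> LV beta pA pB pC -> LV beta qA qB qC ->
  (forall x, pA x * pB x * pC x = Kp) -> (forall x, qA x * qB x * qC x = Kq) ->
  Kp <= Kq -> Kp < / 27 -> 1 < Tq <= Tp ->
  (pA Tp = pA 0 /\ pB Tp = pB 0 /\ pC Tp = pC 0) ->
  (qA Tq = qA 0 /\ qB Tq = qB 0 /\ qC Tq = qC 0) ->
  (forall x y, 0 < x < Tp -> 0 < y < Tp ->
     pA x = pA y -> pB x = pB y -> pC x = pC y -> x = y) ->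
  ln (pA 1) - ln (qA 1) = ln (pA 0) - ln (qA 0) ->
  ln (pB 1) - ln (qB 1) = ln (pB 0) - ln (qB 0) ->
  ln (pC 1) - ln (qC 1) = ln (pC 0) - ln (qC 0) ->
  pA 0 = qA 0 /\ pB 0 = qB 0 /\ pC 0 = qC 0.
Proof.
intros Hb Hp Hq HKp HKq HK HK27 HT [TpA [TpB TpC]] [TqA [TqB TqC]] inj WA WB WC.
destruct (classic (pA 0 = qA 0 /\ pB 0 = qB 0 /\ pC 0 = qC 0))
  as [|ne0]; [assumption|exfalso].
set (vA := ln (pA 0) - ln (qA 0)) in *; set (vB := ln (pB 0) - ln (qB 0)) in *.
set (vC := ln (pC 0) - ln (qC 0)) in *.
set (Lp := fun t => chord_L vA vB vC (pA t) (pB t) (pC t)).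
set (Lq := fun t => chord_L vA vB vC (qA t) (qB t) (qC t)).
assert (sign : forall t lam mu, 0 <= t ->
  ln (pA t) - ln (qA t) = lam * vA + mu -> ln (pB t) - ln (qB t) = lam * vB + mu ->
  ln (pC t) - ln (qC t) = lam * vC + mu -> 0 < lam * Lp t /\ 0 < lam * (Lp t - Lq t)).
{ intros t lam mu Ht E1 E2 E3.
  destruct (Hp t) as [? [? [? [? _]]]], (Hq t) as [? [? [? [? _]]]].
  apply (chord_sign vA vB vC lam mu); try assumption.
  - intros [F1 [F2 F3]]; apply ne0.
    exact (LV_unique_at_0 beta t _ _ _ _ _ _ Hb Ht Hp Hq F1 F2 F3).
  - now rewrite HKp, HKq. }
assert (vne : ~ (vA = vB /\ vB = vC)).
{ intros [E1 E2].
  destruct (sign 0 0 vC ltac:(lra)) as [S _]; fold vA vB vC; lra. }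
set (xp := chord_xi vA vB vC pA pB pC); set (xq := chord_xi vA vB vC qA qB qC).
set (g := fun t => xp t - xq t).
assert (dxp : forall t, is_derive xp t (beta * Lp t)) by (intros; now apply is_derive_chord_xi).
assert (dg : forall t, is_derive g t (beta * (Lp t - Lq t))).
{ intros t; replace (beta * (Lp t - Lq t)) with (beta * Lp t - beta * Lq t) by ring.
  apply (is_derive_minus xp xq); now apply is_derive_chord_xi. }
assert (g0 : g 0 = 0).
{ unfold g, xp, xq, chord_xi, vA, vB, vC; ring. }
assert (g1 : g 1 = 0).
{ rewrite <- g0; unfold g, xp, xq, chord_xi.
  transitivity ((vC - vB) * (ln (pA 1) - ln (qA 1)) + (vA - vC) * (ln (pB 1) - ln (qB 1))
    + (vB - vA) * (ln (pC 1) - ln (qC 1))); [ring|].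
  rewrite WA, WB, WC; unfold vA, vB, vC; ring. }
assert (s0 : 0 < Lp 0 /\ 0 < Lp 0 - Lq 0).
{ destruct (sign 0 1 0) as [? ?]; fold vA vB vC; lra. }
assert (s1 : 0 < Lp 1 /\ 0 < Lp 1 - Lq 1).
{ destruct (sign 1 1 0) as [? ?]; lra. }
(* At a zero of [g], [u = lam v + mu] and [g'] has the sign of [lam], so where [g'] is not positive
   [u] points against [v], and [p] lies on that side of the centre. *)
assert (down : forall t, 0 <= t -> g t = 0 -> beta * (Lp t - Lq t) <= 0 -> Lp t < 0).
{ intros t Ht Gt Dt.
  destruct (parallel vA vB vC (ln (pA t) - ln (qA t)) (ln (pB t) - ln (qB t))
    (ln (pC t) - ln (qC t)) vne) as [lam [mu [E1 [E2 E3]]]].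
  { rewrite <- Gt; unfold g, xp, xq, chord_xi; ring. }
  destruct (sign t lam mu Ht E1 E2 E3) as [S1 S2].
  assert (Lp t - Lq t <= 0) by nra.
  assert (lam < 0) by nra.
  nra. }
(* [g] leaves 0 upwards at time 0 and crosses upwards again at time 1; the half turn [t1] lies
   between. *)
destruct (derive_pos_right g 0 _ 1 (dg 0)) as [r0 [Hr0 Gr0]];
  [apply Rmult_lt_0_compat; lra | lra |].
destruct (first_zero g _ r0 1 dg) as [t1 [Ht1 [Gt1 Dt1]]]; try lra.
assert (L1 := down t1 ltac:(lra) Gt1 Dt1).
assert (t1ne : t1 <> 1) by (intros ->; lra).
(* [Lp] already vanishes once on each side of [t1] before time 1. A further zero after time 1 would
   be a third point of the orbit on a line through the centre within one period. *)
assert (forward : forall t, 1 <= t <= Tp -> 0 < Lp t).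
{ intros t Ht; apply Rnot_le_lt; intros N.
  assert (LT : Lp Tp = Lp 0) by (unfold Lp; now rewrite TpA, TpB, TpC).
  assert (tT : t <> Tp) by (intros ->; lra).
  assert (t1' : t <> 1) by (intros ->; lra).
  destruct (chord_L_zero beta vA vB vC 0 t1 pA pB pC Hp) as [z1 [Hz1 Z1]];
    [lra | fold (Lp 0) (Lp t1); nra|].
  destruct (chord_L_zero beta vA vB vC t1 1 pA pB pC Hp) as [z2 [Hz2 Z2]];
    [lra | fold (Lp 1) (Lp t1); nra|].
  destruct (chord_L_zero beta vA vB vC 1 t pA pB pC Hp) as [z3 [Hz3 Z3]];
    [lra | fold (Lp 1) (Lp t); nra|].
  fold (Lp z1) in Z1; fold (Lp z2) in Z2; fold (Lp z3) in Z3.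
  assert (z1 <> 0) by (intros ->; lra).
  assert (z1 <> t1) by (intros ->; lra).
  assert (z2 <> t1) by (intros ->; lra).
  assert (z2 <> 1) by (intros ->; lra).
  assert (z3 <> 1) by (intros ->; lra).
  destruct (Hp z1) as [? [? [? [? _]]]], (Hp z2) as [? [? [? [? _]]]],
    (Hp z3) as [? [? [? [? _]]]].
  destruct (line_meets_orbit_twice vA vB vC Kp
    (pA z1) (pB z1) (pC z1) (pA z2) (pB z2) (pC z2) (pA z3) (pB z3) (pC z3))
    as [[? [? ?]]|[[? [? ?]]|[? [? ?]]]]; try assumption; try apply HKp.
  - assert (z1 = z2) by (apply inj; (assumption || lra)); lra.
  - assert (z1 = z3) by (apply inj; (assumption || lra)); lra.
  - assert (z2 = z3) by (apply inj; (assumption || lra)); lra. }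
destruct (derive_pos_right g 1 _ Tq (dg 1)) as [r1 [Hr1 Gr1]];
  [apply Rmult_lt_0_compat; lra | lra |].
assert (gT : 0 < g Tq).
{ apply Rnot_le_lt; intros N.
  destruct (first_zero g _ r1 Tq dg) as [t [Ht [Gt Dt]]]; try lra.
  assert (La := down t ltac:(lra) Gt Dt).
  assert (Lb := forward t ltac:(lra)); lra. }
(* Since [xq] has returned to its start, [0 < g Tq] gives [xp 0 < xp Tq]. But [xp] increases from
   [Tq] to [Tp], where it equals [xp 0]. *)
assert (xqT : xq Tq = xq 0) by (unfold xq, chord_xi; now rewrite TqA, TqB, TqC).
assert (xpT : xp Tp = xp 0) by (unfold xp, chord_xi; now rewrite TpA, TpB, TpC).
assert (xp Tq <= xp Tp).
{ destruct (Req_dec Tq Tp) as [->|]; [lra|].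
  left; apply (derive_pos_incr xp _ Tq Tp ltac:(lra) dxp).
  intros t Ht; apply Rmult_lt_0_compat; [exact Hb | apply forward; lra]. }
unfold g in gT, g0; lra.
Qed.

Lemma LV_means (beta rA rB rC : R) (A B C : R -> R) : LV beta A B C ->
  is_RInt A 0 1 rA -> is_RInt B 0 1 rB -> is_RInt C 0 1 rC ->
  ln (A 1) - ln (A 0) = beta * (rC - rB) /\
  ln (B 1) - ln (B 0) = beta * (rA - rC) /\
  ln (C 1) - ln (C 0) = beta * (rB - rA).
Proof.
intros H IA IB IC.
assert (key : forall (f g h : R -> R) (rg rh : R), (forall x, is_derive (fun t => ln (f t)) x (beta * (g x - h x))) ->
  (forall x, continuity_pt g x) -> (forall x, continuity_pt h x) ->
  is_RInt g 0 1 rg -> is_RInt h 0 1 rh -> ln (f 1) - ln (f 0) = beta * (rg - rh)).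
{ intros f g h rg rh D cg ch Ig Ih.
  assert (J : is_RInt (fun x => beta * (g x - h x)) 0 1 (ln (f 1) - ln (f 0))).
  { apply (is_RInt_derive (V := R_CompleteNormedModule) (fun t => ln (f t))); intros x _.
    - apply D.
    - apply continuity_pt_filterlim.
      apply (continuity_pt_scal (minus_fct g h)), continuity_pt_minus; auto. }
  assert (J' : is_RInt (fun x => beta * (g x - h x)) 0 1 (beta * (rg - rh))).
  { apply (is_RInt_scal (V := R_NormedModule) (fun x => g x - h x)).
    now apply (is_RInt_minus (V := R_NormedModule) g h). }
  apply (is_RInt_unique (V := R_CompleteNormedModule)) in J, J'; congruence. }
assert (cA : forall x, continuity_pt A x) by (intros x; now destruct (LV_continuity_pt beta A B C x H)).
assert (cB : forall x, continuity_pt B x) by (intros x; now destruct (LV_continuity_pt beta A B C x H) as [_ [? _]]).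
assert (cC : forall x, continuity_pt C x) by (intros x; now destruct (LV_continuity_pt beta A B C x H) as [_ [_ ?]]).
split; [|split]; [apply (key A C B) | apply (key B A C) | apply (key C B A)]; try assumption;
  intros x; apply (LV_is_derive_ln beta A B C x H).
Qed.

Lemma type1_orbit (beta rA rB rC : R) (A B C : R -> R) : 0 < beta ->
  rA + rB + rC = 1 -> ~ (rA = / 3 /\ rB = / 3 /\ rC = / 3) ->
  ELE_solution beta rA rB rC A B C -> ELE_type1 beta A B C ->
  exists (z : R) (A' B' C' : R -> R), 0 < z < / 3 /\ LV beta A' B' C' /\
    (forall x, A' x * B' x * C' x = orb_K z) /\ orb_K z < / 27 /\
    (forall x, 0 <= x <= 1 -> A x = A' x /\ B x = B' x /\ C x = C' x) /\
    1 < half_period z / beta /\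
    (A' (half_period z / beta) = A' 0 /\ B' (half_period z / beta) = B' 0 /\
     C' (half_period z / beta) = C' 0) /\
    (forall x y, 0 < x < half_period z / beta -> 0 < y < half_period z / beta ->
      A' x = A' y -> B' x = B' y -> C' x = C' y -> x = y) /\
    ln (A' 1) - ln (A' 0) = beta * (rC - rB) /\
    ln (B' 1) - ln (B' 0) = beta * (rA - rC) /\
    ln (C' 1) - ln (C' 0) = beta * (rB - rA).
Proof.
intros Hb Hr nr HE [K27 [t [Ht Hbt]]].
destruct (is_tau_period _ _ Ht) as [z [Hz [EK Et]]].
destruct (proj1 HE 0 ltac:(lra)) as [P0A [P0B [P0C [S0 _]]]].
destruct (orbit_exists beta z (A 0) (B 0) (C 0) Hb Hz) as [A' [B' [C' [H [Hprod [[IA [IB IC]] [[TA [TB TC]] inj]]]]]]];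
  try lra; [exact EK|].
assert (U := LV01_unique beta 0 _ _ _ A' B' C' Hb (ELE_LV01 _ _ _ _ _ _ _ HE)
  (LV_LV01 _ _ _ _ H) ltac:(lra)).
cbv beta in U; rewrite clamp01_id in U by lra.
specialize (U (eq_sym IA) (eq_sym IB) (eq_sym IC)).
assert (eq : forall x, 0 <= x <= 1 -> A x = A' x /\ B x = B' x /\ C x = C' x).
{ intros x Hx; specialize (U x Hx); now rewrite clamp01_id in U by exact Hx. }
destruct HE as [_ [JA [JB JC]]].
assert (ext : forall (f f' : R -> R) (r : R), (forall x, 0 <= x <= 1 -> f x = f' x) -> is_RInt f 0 1 r ->
  is_RInt f' 0 1 r).
{ intros f f' r E; apply is_RInt_ext; rewrite Rmin_left, Rmax_right by lra.
  intros x Hx; apply E; lra. }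
assert (M := LV_means beta rA rB rC A' B' C' H
  (ext _ _ _ (fun x Hx => proj1 (eq x Hx)) JA)
  (ext _ _ _ (fun x Hx => proj1 (proj2 (eq x Hx))) JB)
  (ext _ _ _ (fun x Hx => proj2 (proj2 (eq x Hx))) JC)).
exists z, A', B', C'.
rewrite <- EK.
do 2 (split; [assumption|]).
split; [rewrite EK; exact Hprod|].
split; [exact K27|].
split; [exact eq|].
rewrite IA, IB, IC.
split; [|do 2 (split; [auto|]); rewrite <- IA, <- IB, <- IC; exact M].
(* Type 1 gives a period of at least 1. A period of exactly 1 would make all log-ratios zero, hence
   all means equal to 1/3. *)
assert (T1 : 1 <= half_period z / beta).
{ apply (Rmult_le_reg_r beta); [exact Hb|].
  unfold Rdiv; rewrite Rmult_assoc, Rinv_l by lra; lra. }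
destruct T1 as [T1|T1]; [exact T1|exfalso].
rewrite <- T1 in TA, TB, TC.
rewrite TA, TB, TC, IA, IB, IC, !Rminus_diag in M.
destruct M as [M1 [M2 M3]].
assert (canc : forall w, 0 = beta * w -> w = 0).
{ intros w E; symmetry in E; apply Rmult_integral in E; lra. }
apply canc in M1, M2, M3; apply nr; repeat split; lra.
Qed.

Lemma orb_K_mono (z w : R) : 0 < z <= w -> orb_K z <= orb_K w.
Proof.
intros H; unfold orb_K; apply Rmult_le_compat_r; [lra|].
assert (P : z ^ 2 <= w ^ 2) by (apply pow_incr; lra).
apply Rmult_le_compat; [apply pow2_ge_0 | lra | exact P | lra].
Qed.

Theorem theorem6p1 :
  forall (beta rA rB rC : R),
    0 < beta -> 0 < rA -> 0 < rB -> 0 < rC -> rA + rB + rC = 1 ->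
    ~ (rA = / 3 /\ rB = / 3 /\ rC = / 3) ->
    forall (pA pB pC qA qB qC : R -> R),
      ELE_solution beta rA rB rC pA pB pC -> ELE_type1 beta pA pB pC ->
      ELE_solution beta rA rB rC qA qB qC -> ELE_type1 beta qA qB qC ->
      forall x, 0 <= x <= 1 -> pA x = qA x /\ pB x = qB x /\ pC x = qC x.
Proof.
intros beta rA rB rC Hb HA HB HC Hr nr pA pB pC qA qB qC Ep Tp Eq Tq.
destruct (type1_orbit beta rA rB rC pA pB pC Hb Hr nr Ep Tp)
  as [z [pA' [pB' [pC' [Hz [Hp [Kp [Kp27 [eqp [T1p [Tpp [injp [MpA [MpB MpC]]]]]]]]]]]]]].
destruct (type1_orbit beta rA rB rC qA qB qC Hb Hr nr Eq Tq)
  as [w [qA' [qB' [qC' [Hw [Hq [Kq [Kq27 [eqq [T1q [Tqq [injq [MqA [MqB MqC]]]]]]]]]]]]]].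
assert (period : forall u v, 0 < u <= v -> v < / 3 -> half_period v / beta <= half_period u / beta).
{ intros u v Hu Hv; apply Rmult_le_compat_r; [|now apply half_period_mono].
  left; now apply Rinv_0_lt_compat. }
assert (start : pA' 0 = qA' 0 /\ pB' 0 = qB' 0 /\ pC' 0 = qC' 0).
(* The smaller parameter has the smaller product, that is, the outer orbit; this solution takes the
   role of [p]. *)
{ destruct (Rle_lt_dec z w) as [L|L].
  - apply (no_full_turn beta (orb_K z) (orb_K w) (half_period z / beta) (half_period w / beta));
      try assumption; try lra.
    + apply orb_K_mono; lra.
    + split; [exact T1q | apply period; lra].
  - assert (S : qA' 0 = pA' 0 /\ qB' 0 = pB' 0 /\ qC' 0 = pC' 0);
      [|destruct S as [? [? ?]]; auto].
    apply (no_full_turn beta (orb_K w) (orb_K z) (half_period w / beta) (half_period z / beta));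
      try assumption; try lra.
    + apply orb_K_mono; lra.
    + split; [exact T1p | apply period; lra]. }
destruct start as [E1 [E2 E3]].
intros x Hx.
destruct (eqp x Hx) as [-> [-> ->]], (eqq x Hx) as [-> [-> ->]].
exact (LV01_unique beta 0 _ _ _ _ _ _ Hb (LV_LV01 _ _ _ _ Hp) (LV_LV01 _ _ _ _ Hq)
  ltac:(lra) E1 E2 E3 x Hx).
Qed.
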